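(* Let $(x_k)_{k\ge0}$ and $(y_k)_{k\ge0}$ be the sequences generated by the sVAST algorithm (defined in the context) for the problem $\min_{x\in\mathcal H}F(x)=f(x)+g(Kx)$. Put $\rho_1:=0$ and assume that for all $k\ge1$ $$\rho_{k+1}:=t_k^2-t_{k+1}^2+t_{k+1}\ge0 .$$ Then for every optimal solution $x^*$ of the problem (i.e. every minimizer of $F$ over $\mathcal H$) and every $N\ge1$, $$\mathbb E\left(F(x_N)-F(x^* )\right)\le\frac1{\gamma_Nt_N^2}\,\frac12\lVert x_0-x^*\rVert^2+\frac1{\gamma_Nt_N^2}\,\frac{L_g^2}{2\lVert K\rVert^2}\sum_{k=1}^N\mu_k^2(t_k+\rho_k)+\frac1{\gamma_Nt_N^2}\left(\frac{\sigma^2}{\lVert K\rVert^4}+\frac{L_g^2+1}{2\lVert K\rVert^2}\right)\sum_{k=1}^Nt_k^2\mu_k^2 .$$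
   Context: $\mathcal H,\mathcal G$ are real Hilbert spaces; $f:\mathcal H\to\overline{\mathbb R}$ (extended reals) is proper, convex and lower semicontinuous; $g:\mathcal G\to\mathbb R$ is convex and $L_g$-Lipschitz continuous with $L_g>0$; $K:\mathcal H\to\mathcal G$ is a nonzero continuous linear operator. Put $F:=f+g\circ K$. $g^*$ denotes the convex (Fenchel) conjugate of $g$. For $\mu\ge0$ the Moreau envelope of $g$ is ${}^{\mu}g(x):=\sup_{p\in\mathcal G}\{\langle x,p\rangle-g^*(p)-\frac\mu2\lVert p\rVert^2\}$; for $\mu>0$ it is Fréchet differentiable. $\operatorname{prox}_{h}(x)$ denotes the unique minimizer of $u\mapsto h(u)+\frac12\lVert u-x\rVert^2$ for $h$ proper, convex, lower semicontinuous. sVAST algorithm: let $y_0=x_0\in\mathcal H$ (deterministic), let $(\mu_k)_{k\ge1}$ be a nonincreasing sequence of positive reals, and let $(t_k)_{k\ge1}$ be real numbers with $t_1=1$ and $t_k\ge1$ for $k\ge2$. For every $k\ge1$ set $L_k=\frac{\lVert K\rVert^2}{\mu_k}$, $\gamma_k=\frac1{L_k}$, $$x_k=\operatorname{prox}_{\gamma_kf}(y_{k-1}-\gamma_k\xi_{k-1}),\qquad y_k=x_k+\frac{t_k-1}{t_{k+1}}(x_k-x_{k-1}),$$ where $(\xi_k)_{k\ge0}$ are $\mathcal H$-valued random variables such that, with $\mathbb E_k(\cdot):=\mathbb E(\cdot\mid\sigma(x_0,\dots,x_k))$ and some constant $\sigma\geq 0$, for every $k\ge0$ $$\mathbb E_k(\xi_k)=\nabla({}^{\mu_{k+1}}g\circ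 K)(y_k),\qquad \mathbb E_k\left(\lVert\xi_k-\nabla({}^{\mu_{k+1}}g\circ K)(y_k)\rVert^2\right)\le\sigma^2 .$$ *)

(* Defs.v *)
From HB Require Import structures.
From mathcomp Require Import all_boot all_order all_algebra.
From mathcomp Require Import all_classical all_reals all_analysis.
From mathcomp Require Import measurable_realfun.

Set Implicit Arguments.
Unset Strict Implicit.
Unset Printing Implicit Defensive.

Import Order.TTheory GRing.Theory Num.Theory.
Import numFieldNormedType.Exports.

Local Open Scope classical_set_scope.
Local Open Scope ring_scope.
Local Open Scope ereal_scope.

HB.mixin Record CompleteNormedModule_isHilbert (R : realType) V
    & CompleteNormedModule R V := {
  inner : V -> V -> R ;
  innerC : forall u v, inner u v = inner v u ;
  innerDl : forall u v w, inner (u + v)%R w = (inner u w + inner v w)%R ;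
  innerZl : forall (a : R) u v, inner (a *: u)%R v = (a * inner u v)%R ;
  inner_norm : forall u : V, inner u u = (`|u| ^+ 2)%R
}.

#[short(type="hilbertType")]
HB.structure Definition Hilbert (R : realType) :=
  {V of CompleteNormedModule_isHilbert R V & CompleteNormedModule R V}.

Section convex_analysis.
Context {R : realType}.

Definition proper_ereal {H : Type} (f : H -> \bar R) :=
  (forall u, f u != -oo) /\ (exists u, f u != +oo).

(* Only used for functions that never take the value -oo, so that the
   right-hand side involves no indeterminate sum. *)
Definition convex_ereal {H : lmodType R} (f : H -> \bar R) :=
  forall (u v : H) (a : R), (0 < a < 1)%R ->
    f (a *: u + (1 - a) *: v)%R <= a%:E * f u + (1 - a)%:E * f v.

Definition opnorm {H G : normedModType R} (K : H -> G) : R :=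
  sup [set `|K u|%R | u in [set u : H | (`|u| <= 1)%R]].

Definition fenchel_conj {G : hilbertType R} (g : G -> \bar R) (p : G) : \bar R :=
  ereal_sup [set (inner u p)%:E - g u | u in [set: G]].

(* Written through the conjugate, so that the value at mu = 0 is the
   biconjugate of g. *)
Definition moreau_envelope {G : hilbertType R} (mu : R) (g : G -> \bar R)
    (u : G) : \bar R :=
  ereal_sup [set (inner u p)%:E - fenchel_conj g p - (mu / 2 * `|p| ^+ 2)%:E
            | p in [set: G]].

(* The minimizer is unique when h is proper, convex and lower semicontinuous;
   the value is 0 if there is no minimizer. *)
Definition prox {H : hilbertType R} (h : H -> \bar R) (u : H) : H :=
  xget 0%R [set p | forall v, h p + (2^-1 * `|p - u| ^+ 2)%:E <=
                              h v + (2^-1 * `|v - u| ^+ 2)%:E].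

(* Riesz representative of the Frechet derivative; 0 if h is not
   differentiable at u. *)
Definition gradient {H : hilbertType R} (h : H -> R) (u : H) : H :=
  xget 0%R [set v | is_diff u (h : H -> R^o) (inner v)].

End convex_analysis.

Section vector_integration.
Context {R : realType} {V : normedModType R}.

Definition simple_wrt {T : Type} (S : set_system T) (s : T -> V) :=
  finite_set (range s) /\ forall v, S (s @^-1` [set v]).

(* Measurability of V-valued maps in the sense of Bochner; it coincides with
   Borel measurability when V is separable. *)
Definition strongly_measurable {T : Type} (S : set_system T) (X : T -> V) :=
  exists s : nat -> T -> V, (forall n, simple_wrt S (s n)) /\
    (forall w, s n w @[n --> \oo] --> X w).

Context {d : measure_display} {T : measurableType d}.

Definition simple_integral (P : probability T R) (A : set T) (s : T -> V) : V :=
  (\sum_(v \in range s) fine (P (A `&` s @^-1` [set v])) *: v)%R.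

Definition is_bochner_integral (P : probability T R) (A : set T) (X : T -> V)
    (v : V) :=
  exists s : nat -> T -> V,
    [/\ forall n, simple_wrt measurable (s n),
        \int[P]_(w in A) `|X w - s n w|%:E @[n --> \oo] --> 0 &
        simple_integral P A (s n) @[n --> \oo] --> v].

Definition bochner_integrable (P : probability T R) (X : T -> V) :=
  strongly_measurable measurable X /\ \int[P]_w `|X w|%:E < +oo.

(* Y is a version of the conditional expectation of X given S. *)
Definition is_cond_expectation (P : probability T R) (S : set_system T)
    (X Y : T -> V) :=
  [/\ bochner_integrable P X, bochner_integrable P Y,
      strongly_measurable S Y &
      forall A, S A ->
        exists2 v, is_bochner_integral P A X v & is_bochner_integral P A Y v].

End vector_integration.

Section probability.
Context {R : realType} {d : measure_display} {T : measurableType d}.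

(* Y is a version of the conditional expectation of X given S, where X >= 0
   need not be integrable. *)
Definition is_cond_expectation_ge0 (P : probability T R) (S : set_system T)
    (X Y : T -> \bar R) :=
  [/\ measurable_fun [set: T] X /\ (forall w, 0 <= X w),
      forall B, measurable B -> S (Y @^-1` B),
      forall w, 0 <= Y w &
      forall A, S A -> \int[P]_(w in A) X w = \int[P]_(w in A) Y w].

(* The sigma-algebra generated by X 0, ..., X k. *)
Definition sigma_upto {H : topologicalType} (X : nat -> T -> H) (k : nat) :
    set_system T :=
  <<s \bigcup_(i in `I_k.+1) preimage_set_system setT (X i) <<s @open H >> >>.

Definition cond_mean_eq {V : normedModType R} (P : probability T R)
    (S : set_system T) (X v : T -> V) :=
  exists2 Y, is_cond_expectation P S X Y & {ae P, forall w, Y w = v w}.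

Definition cond_mean_le (P : probability T R) (S : set_system T)
    (X : T -> \bar R) (c : \bar R) :=
  exists2 Y, is_cond_expectation_ge0 P S X Y & {ae P, forall w, Y w <= c}.

End probability.

Section sVAST.
Context {R : realType} {H G : hilbertType R}.
Context {d : measure_display} {T : measurableType d}.

Definition objective (f : H -> \bar R) (g : G -> R) (K : H -> G) (u : H) :
    \bar R := f u + (g (K u))%:E.

(* The envelope is finite for mu > 0 and g real-valued, convex, Lipschitz. *)
Definition smoothed_gradient (g : G -> R) (K : H -> G) (mu : R) : H -> H :=
  gradient (fun u => fine (moreau_envelope mu (EFin \o g) (K u))).

Definition smoothness (K : H -> G) (mu : nat -> R) (k : nat) : R :=
  (opnorm K ^+ 2 / mu k)%R.

Definition stepsize (K : H -> G) (mu : nat -> R) (k : nat) : R :=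
  (1 / smoothness K mu k)%R.

(* mu 0 and t 0 are never used. *)
Definition sVAST_iterates (f : H -> \bar R) (K : H -> G) (mu t : nat -> R)
    (xi : nat -> T -> H) (x0 : H) (x y : nat -> T -> H) :=
  [/\ forall w, x 0%N w = x0,
      forall w, y 0%N w = x0,
      forall k w, x k.+1 w =
        prox (fun u => (stepsize K mu k.+1)%:E * f u)
             (y k w - stepsize K mu k.+1 *: xi k w)%R &
      forall k w, y k.+1 w =
        (x k.+1 w + ((t k.+1 - 1) / t k.+2) *: (x k.+1 w - x k w))%R].

Definition sVAST_oracle (g : G -> R) (K : H -> G) (mu : nat -> R) (sigma : R)
    (P : probability T R) (xi x y : nat -> T -> H) :=
  forall k,
    let grad w := smoothed_gradient g K (mu k.+1) (y k w) in
    cond_mean_eq P (sigma_upto x k) (xi k) grad /\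
    cond_mean_le P (sigma_upto x k)
      (fun w => (`|xi k w - grad w| ^+ 2)%:E) (sigma ^+ 2)%:E.

End sVAST.

(* Main.v *)
Require Import Defs.
From HB Require Import structures.
From mathcomp Require Import all_boot all_order all_algebra.
From mathcomp Require Import all_classical all_reals all_analysis.
From mathcomp Require Import measurable_realfun.
From mathcomp Require Import ring lra.

(* Let F = f + g o K, gamma_k = mu_k / |K|^2, and let eps_(k-1) be the noise of
   the k-th stochastic gradient.  The smoothed function is convex and
   1/gamma_k-smooth, and it lies between g o K - mu_k Lg^2 / 2 and g o K.  Hence
   one proximal gradient step gives, for every z,
     gamma_k (F(x_k) - mu_k Lg^2 / 2) + |z - x_k|^2 / 2
       <= gamma_k F(z) + |z - y_(k-1)|^2 / 2 + gamma_k <eps_(k-1), z - x_k>.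
   Take z = (1 - 1/t_k) x_(k-1) + xstar / t_k and multiply by t_k^2.  Because
   gamma_k (t_k^2 - t_k) <= gamma_(k-1) t_(k-1)^2, the quantities
     gamma_k t_k^2 (F(x_k) - F(xstar)) + |t_k x_k - (t_k - 1) x_(k-1) - xstar|^2 / 2
   telescope along every trajectory.  Replacing x_k by the exact proximal
   gradient point costs gamma_k |eps_(k-1)|^2; what remains of the noise term is
   the inner product of eps_(k-1) with a vector measurable for the past, whose
   expectation is zero.  Working with F instead of the smoothed objectives
   avoids comparing envelopes with different mu. *)

Set Implicit Arguments.
Unset Strict Implicit.
Unset Printing Implicit Defensive.

Import Order.TTheory GRing.Theory Num.Theory.
Import numFieldNormedType.Exports.

Local Open Scope classical_set_scope.
Local Open Scope ring_scope.

(** The envelope is given only as a supremum over dual vectors and its gradient only through [xget],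
    so nothing about them is available by definition. All their calculus is drawn from one source,
    the strong minimality inequality of a proximal point: applied to [mu * g] it gives duality,
    convexity, smoothness and the gradient, and applied to a linear functional it gives the Riesz
    theorem, which stands in for the adjoint of [K]. On the probabilistic side the cross term can be
    integrated only once noise and direction are square integrable, and nothing of the kind is
    assumed of the iterates. It is propagated by induction: every update is a Lipschitz image of
    square-integrable data. Conditional unbiasedness speaks of vector integrals over events; it is
    tested against fixed vectors, then against simple maps, and reaches a general past-measurable
    direction by dominated convergence. *)

Lemma lipschitz_map_continuous {R : realType} {V W : normedModType R}
    (phi : V -> W) (c : R) :
  (forall u v, `|phi u - phi v| <= c * `|u - v|) -> continuous phi.
Proof.
move=> lphi u; apply/cvgrPdist_le => e e0.
have c0 : 0 < 1 + `|c| by rewrite ltr_pwDl.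
near=> v.
have huv : `|u - v| <= e / (1 + `|c|).
  by near: v; apply: cvgr_dist_le => //; exact: divr_gt0.
apply: le_trans (lphi _ _) _.
apply: (@le_trans _ _ ((1 + `|c|) * `|u - v|)).
  by rewrite ler_wpM2r// (le_trans (ler_norm c))// lerDr.
by rewrite mulrC -ler_pdivlMr.
Unshelve. all: by end_near. Qed.

(** * Inner products *)

Section inner_product.
Context {R : realType} {H : hilbertType R}.
Implicit Types (u v w z : H) (a : R).

Lemma inner0l u : inner 0 u = 0.
Proof. by rewrite -(scale0r (0 : H)) innerZl mul0r. Qed.

Lemma innerNl u v : inner (- u) v = - inner u v.
Proof. by rewrite -scaleN1r innerZl mulN1r. Qed.

Lemma innerBl u v w : inner (u - v) w = inner u w - inner v w.
Proof. by rewrite innerDl innerNl. Qed.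

Lemma innerDr u v w : inner u (v + w) = inner u v + inner u w.
Proof. by rewrite innerC innerDl !(innerC u). Qed.

Lemma innerZr a u v : inner u (a *: v) = a * inner u v.
Proof. by rewrite innerC innerZl innerC. Qed.

Lemma inner0r u : inner u 0 = 0.
Proof. by rewrite innerC inner0l. Qed.

Lemma innerNr u v : inner u (- v) = - inner u v.
Proof. by rewrite innerC innerNl innerC. Qed.

Lemma innerBr u v w : inner u (v - w) = inner u v - inner u w.
Proof. by rewrite innerDr innerNr. Qed.

Definition innerE := (@innerDl R H, innerDr, @innerZl R H, innerZr,
  innerNl, innerNr, inner0l, inner0r).

Lemma inner_ge0 u : 0 <= inner u u.
Proof. by rewrite inner_norm sqr_ge0. Qed.

(** Expand [|a u - v|^2 >= 0] and divide by [2 a]. *)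
Lemma inner_young a u v : 0 < a ->
  inner u v <= a / 2 * `|u| ^+ 2 + (2 * a)^-1 * `|v| ^+ 2.
Proof.
move=> a0; have := inner_ge0 (a *: u - v).
rewrite -!inner_norm !innerE (innerC v u) => h.
rewrite -subr_ge0 -(pmulr_rge0 _ (_ : 0 < 2 * a)) ?mulr_gt0//.
suff -> : 2 * a * (a / 2 * inner u u + (2 * a)^-1 * inner v v - inner u v) =
  a * (a * inner u u) - a * inner u v - (a * inner u v - inner v v) by lra.
by field; rewrite lt0r_neq0.
Qed.

Lemma inner_cauchy u v : `|inner u v| <= `|u| * `|v|.
Proof.
have [->|u0] := eqVneq u 0; first by rewrite inner0l !normr0 mul0r.
have nu : 0 < `|u| by rewrite normr_gt0.
suff H1 w : inner u w <= `|u| * `|w|.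
  by rewrite ler_norml H1 andbT lerNl -innerNr -(normrN v) H1.
have [->|w0] := eqVneq w 0; first by rewrite inner0r normr0 mulr0.
have nw : 0 < `|w| by rewrite normr_gt0.
(* This parameter balances the two terms of Young's inequality: each becomes [|u| |w| / 2]. *)
apply: le_trans (@inner_young (`|w| / `|u|) u w _) _; first exact: divr_gt0.
rewrite le_eqVlt; apply/orP; left; apply/eqP.
by field; rewrite ?gt_eqF.
Qed.

Lemma inner_continuous u : continuous (inner u : H -> R^o).
Proof.
apply: (@lipschitz_map_continuous _ _ _ _ `|u|) => v w.
by rewrite -innerBr; exact: inner_cauchy.
Qed.

Lemma inner_is_linear u : linear (inner u : H -> R^o).
Proof. by move=> a v w; rewrite innerDr innerZr. Qed.

Lemma inner_inj u v : inner u = inner v -> u = v.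
Proof.
move=> uv; apply/eqP; rewrite -subr_eq0 -normr_eq0 -sqrf_eq0 -inner_norm.
by rewrite innerBl uv subrr.
Qed.

End inner_product.

(** * Proximal maps *)

Section proximal_map.
Context {R : realType} {H : hilbertType R}.
Implicit Types (u v w z : H) (a : R) (h : H -> \bar R).

(** The last term is the exact gain from strong convexity of the square. It produces the extra
    square in [is_prox_strong] and makes minimizing sequences Cauchy. *)
Lemma normD_conv a u v z :
  `|a *: u + (1 - a) *: v - z| ^+ 2 =
  a * `|u - z| ^+ 2 + (1 - a) * `|v - z| ^+ 2 - a * (1 - a) * `|u - v| ^+ 2.
Proof.
rewrite -!inner_norm !innerE (innerC v u) (innerC z u) (innerC z v).
by ring.
Qed.

(** Replaces the limit [a -> 0+]: if [D < 0], the explicit [a = - D / (2 (|c| - D))] keeps [D + a c]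
    at most [D / 2]. *)
Lemma ge0_of_small_perturb (D c : R) :
  (forall a, 0 < a < 1 -> 0 <= D + a * c) -> 0 <= D.
Proof.
move=> Dc; rewrite leNgt; apply/negP => D0.
have c0 : 0 <= `|c| by [].
have den : 0 < 2 * (`|c| - D) by lra.
have a01 : 0 < - D / (2 * (`|c| - D)) < 1.
  by rewrite divr_gt0 ?oppr_gt0//= ltr_pdivrMr// mul1r; lra.
have := Dc _ a01; apply/negP; rewrite -ltNge.
suff : - D / (2 * (`|c| - D)) * c <= - D / 2 by lra.
apply: (@le_trans _ _ (- D / (2 * (`|c| - D)) * (`|c| - D))); last first.
  rewrite le_eqVlt; apply/orP; left; apply/eqP; field.
  by rewrite gt_eqF//; lra.
rewrite ler_pM2l; last by case/andP: a01.
by have := ler_norm c; lra.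
Qed.

Lemma proper_ereal_exists h : proper_ereal h ->
  exists (u : H) (r : R), h u = r%:E.
Proof.
move=> [hN [u hu]]; exists u, (fine (h u)).
by rewrite fineK// fin_numE hN hu.
Qed.

(** A cone replaces the usual affine minorant and needs no separation theorem. Semicontinuity bounds
    [h] below by [r - 1] on a ball of radius [e] around a point of finite value [r]; convexity along
    segments from the centre carries the bound outwards with slope [2 / e]. *)
Lemma lsc_convex_minorant h : proper_ereal h -> convex_ereal h ->
  lower_semicontinuous h ->
  exists (u0 : H) (b c : R), 0 <= b /\ forall u, ((c - b * `|u - u0|)%:E <= h u)%E.
Proof.
move=> hp hc hl; have [u0 [r hr]] := proper_ereal_exists hp.
have hN := hp.1.
have [V /nbhs_ballP[e/= e0 eV] Vh] : exists2 V : set H, nbhs u0 V &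
    forall u, V u -> ((r - 1)%:E < h u)%E.
  by apply: hl; rewrite hr lte_fin; lra.
exists u0, (2 / e), (r - 1); split=> [|u]; first by rewrite divr_ge0// ltW.
have [ue|ue] := ltP `|u - u0| e.
  apply/ltW/(@le_lt_trans _ _ (r - 1)%:E); last first.
    by apply/Vh/eV; rewrite -ball_normE /= distrC.
  rewrite lee_fin -[leRHS]subr0 lerD2l lerN2 mulr_ge0// ?divr_ge0//.
  exact: ltW.
have d0 : 0 < `|u - u0| by apply: lt_le_trans ue.
case hq: (h u) => [q| |].
(* This weight puts the point of the segment at distance [e / 2] from [u0], inside the ball. *)
- set s := e / (2 * `|u - u0|).
  have s01 : 0 < s < 1.
    rewrite /s divr_gt0 ?mulr_gt0//= ltr_pdivrMr ?mulr_gt0// mul1r; lra.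
  have : ((r - 1)%:E < h (s *: u + (1 - s) *: u0)%R)%E.
    apply/Vh/eV; rewrite -ball_normE /=.
    have -> : u0 - (s *: u + (1 - s) *: u0) = - (s *: (u - u0)).
      by rewrite scalerBl scale1r scalerBr addrCA opprD addNKr.
    rewrite normrN normrZ gtr0_norm; last by case/andP: s01.
    rewrite /s invfM mulrA mulfVK ?gt_eqF//; lra.
  move=> /lt_le_trans/(_ (hc u u0 s s01)).
  rewrite hq hr -!EFinM -EFinD lte_fin => h1; rewrite lee_fin.
  have -> : 2 / e * `|u - u0| = s^-1 by rewrite /s invf_div; field; rewrite gt_eqF.
  have s0 : 0 < s by case/andP: s01.
  have h2 : s * (r - q) < 1 by lra.
  have : r - q < s^-1 by rewrite -(ltr_pM2l s0) divff// gt_eqF.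
  lra.
- by rewrite leey.
- by move: (hN u); rewrite hq.
Qed.

Definition is_prox h z p := forall v,
  (h p + (2^-1 * `|p - z| ^+ 2)%:E <= h v + (2^-1 * `|v - z| ^+ 2)%:E)%E.

Lemma is_prox_fin h z p : proper_ereal h -> is_prox h z p ->
  exists r : R, h p = r%:E.
Proof.
move=> hp hz; have [u0 [r hr]] := proper_ereal_exists hp.
case hq: (h p) => [q| |]; first by exists q.
- by move: (hz u0); rewrite hq hr addye// -EFinD leye_eq.
- by move: (hp.1 p); rewrite hq.
Qed.

(** Compare [p] with [a v + (1 - a) p], divide by [a] and let [a] tend to 0; the gain in
    [normD_conv] leaves [|v - p|^2 / 2]. *)
Lemma is_prox_strong h z p v : proper_ereal h -> convex_ereal h ->
  is_prox h z p ->
  (h p + (2^-1 * `|p - z| ^+ 2 + 2^-1 * `|v - p| ^+ 2)%:E <=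
   h v + (2^-1 * `|v - z| ^+ 2)%:E)%E.
Proof.
move=> hp hc hz; have [r hr] := is_prox_fin hp hz.
case hv: (h v) => [q| |]; last by move: (hp.1 v); rewrite hv.
  2: by rewrite addye// leey.
rewrite hr -!EFinD lee_fin -subr_ge0.
apply: (ge0_of_small_perturb (c := 2^-1 * `|v - p| ^+ 2)) => a a01.
have := hz (a *: v + (1 - a) *: p).
have := hc v p a a01; rewrite hr hv -!EFinM -EFinD => h1 h2.
have {h2}:= le_trans h2 (leeD h1 (lexx _)).
rewrite -!EFinD lee_fin normD_conv => h2.
have [a0 _] := andP a01.
rewrite -(pmulr_rge0 _ a0); lra.
Qed.

(** Testing the strong inequality of each point at the other and adding gives firm nonexpansiveness,
    [|p - q|^2 <= inner (p - q) (z - w)]; Cauchy-Schwarz does the rest. *)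
Lemma is_prox_nonexpansive h z w p q : proper_ereal h -> convex_ereal h ->
  is_prox h z p -> is_prox h w q -> `|p - q| <= `|z - w|.
Proof.
move=> hp hc hz hw.
have [r hr] := is_prox_fin hp hz; have [s hs] := is_prox_fin hp hw.
have := is_prox_strong p hp hc hw; have := is_prox_strong q hp hc hz.
rewrite hr hs -!EFinD !lee_fin => h1 h2.
have h3 : `|p - q| ^+ 2 <= inner (p - q) (z - w).
  move: h1 h2; rewrite -!inner_norm !innerE.
  by rewrite (innerC z q) (innerC z p) (innerC w q) (innerC w p) (innerC q p); lra.
have [->|pq] := eqVneq `|p - q| 0; first by [].
have pq0 : 0 < `|p - q| by rewrite lt0r pq /=.
rewrite -(ler_pM2l pq0) -expr2; apply: le_trans h3 _.
exact: le_trans (ler_norm _) (inner_cauchy _ _).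
Qed.

(** Strong convexity makes any minimizing sequence Cauchy, so completeness of the norm suffices and
    no weak compactness enters. The conical minorant keeps the infimum finite, since the square
    dominates a linear decrease. *)
Lemma is_prox_exists h z : proper_ereal h -> convex_ereal h ->
  lower_semicontinuous h -> exists p, is_prox h z p.
Proof.
move=> hp hc hl.
have [u0 [b [c [b0 hb]]]] := lsc_convex_minorant hp hc hl.
pose phi u := (h u + (2^-1 * `|u - z| ^+ 2)%:E)%E.
pose M := ereal_inf (range phi).
have phiM u : (M <= phi u)%E by apply: ereal_inf_lbound; exists u.
have MNy : M != -oo%E.
  suff : ((c - b * `|z - u0| - b ^+ 2 / 2)%:E <= M)%E.
    by move=> h1; rewrite gt_eqF// (lt_le_trans (ltNyr _) h1).
  apply: le_ereal_inf_tmp => _ [u _ <-].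
  apply: le_trans (leeD (hb u) (lexx _)); rewrite -EFinD lee_fin.
  have h1 : `|u - u0| <= `|u - z| + `|z - u0| by exact: ler_distD.
  have h2 : b * `|u - u0| <= b * (`|u - z| + `|z - u0|) by apply: ler_wpM2l.
  by have := sqr_ge0 (`|u - z| - b); nra.
have My : M != +oo%E.
  have [u [r hr]] := proper_ereal_exists hp.
  by rewrite lt_eqF// (le_lt_trans (phiM u))// /phi hr -EFinD ltry.
have Mfin : M \is a fin_num by rewrite fin_numE MNy My.
pose m := fine M; have mM : M = m%:E by rewrite fineK.
have ex n : exists u, (phi u < (m + n.+1%:R^-1)%:E)%E.
  have /ereal_inf_lt[_ [u _ <-] hu] : (M < (m + n.+1%:R^-1)%:E)%E.
    by rewrite mM lte_fin ltrDl invr_gt0.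
  by exists u.
have [s hs] := choice ex.
have /choice[r hfin] n : exists r : R, h (s n) = r%:E.
  exists (fine (h (s n))); rewrite fineK// fin_numE hp.1/=; apply/eqP => hy.
  by have := hs n; rewrite /phi hy addye.
(* The value at the midpoint is at least [m], yet lies [|s i - s j|^2 / 8] below the average of two
   nearly minimal values. *)
have gap i j : `|s i - s j| ^+ 2 <= 4 * (i.+1%:R^-1 + j.+1%:R^-1).
  have half01 : 0 < (2^-1 : R) < 1 by lra.
  have := phiM (2^-1 *: s i + (1 - 2^-1) *: s j); rewrite mM /phi => h1.
  have h2 := hc (s i) (s j) _ half01.
  have {h2}:= le_trans h1 (leeD h2 (lexx _)).
  have := hs i; have := hs j; rewrite /phi !hfin.
  move: (i.+1%:R^-1) (j.+1%:R^-1) => ei ej.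
  rewrite -!EFinM -!EFinD !lte_fin lee_fin normD_conv.
  by lra.
have : cvg (s @ \oo).
  apply/cauchy_cvgP/cauchy_ballP => e e0; near_simpl.
  have e20 : 0 < e ^+ 2 / 8 by rewrite divr_gt0// exprn_gt0.
  have small := near_infty_natSinv_lt (PosNum e20).
  exists ([set n | n.+1%:R^-1 < e ^+ 2 / 8], [set n | n.+1%:R^-1 < e ^+ 2 / 8]).
    by split; exact: small.
  move=> [i j] /= [hi hj]; rewrite -ball_normE /=.
  suff : `|s i - s j| ^+ 2 < e ^+ 2 by rewrite ltr_pXn2r// ?nnegrE// ltW.
  apply: le_lt_trans (gap _ _) _.
  by move: (i.+1%:R^-1) (j.+1%:R^-1) hi hj => ei ej; lra.
move=> /cvg_ex[p sp]; exists p => v; apply: le_trans (phiM v).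
rewrite leNgt; apply/negP; rewrite mM => pm.
(* If [p] were not minimal, a real level [a] would separate [m] from the value at [p], even when
   [h p] is [+oo]. Semicontinuity keeps [h (s n)] above [a], which contradicts [phi (s n) -> m]. *)
have [a [am ap]] : exists a : R, (m < a + 2^-1 * `|p - z| ^+ 2)%R /\ (a%:E < h p)%E.
  move: pm; case: (h p) (hp.1 p) => [q| |]// _ pm.
    exists ((q + m - 2^-1 * `|p - z| ^+ 2) / 2).
    by move: pm; rewrite -EFinD !lte_fin => pm; split; lra.
  by exists (m - 2^-1 * `|p - z| ^+ 2 + 1); split; [lra|rewrite ltry].
have [V pV Vh] := hl _ _ ap.
have nc : (fun n => m + n.+1%:R^-1 - (a + 2^-1 * `|s n - z| ^+ 2)) @ \oo -->
    m + 0 - (a + 2^-1 * `|p - z| ^+ 2).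
  apply: cvgB; first by apply: cvgD; [exact: cvg_cst|exact: cvg_harmonic].
  apply: cvgD; first exact: cvg_cst.
  have nz : `|s n - z| @[n --> \oo] --> `|p - z|.
    by apply: cvg_norm; apply: cvgB => //; exact: cvg_cst.
  by apply: cvgM; [exact: cvg_cst|exact: (cvgM nz nz)].
suff : 0 <= m + 0 - (a + 2^-1 * `|p - z| ^+ 2) by lra.
rewrite -(cvg_lim _ nc)//; apply: limr_ge; first by apply/cvg_ex; eexists; exact: nc.
near=> n.
have /Vh h1 : V (s n) by near: n; exact: sp.
have := hs n; rewrite /phi hfin -EFinD lte_fin => h2.
by move: h1 h2; rewrite hfin lte_fin; move: (n.+1%:R^-1) => e; lra.
Unshelve. all: by end_near. Qed.

Lemma proxP h z : proper_ereal h -> convex_ereal h ->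
  lower_semicontinuous h -> is_prox h z (prox h z).
Proof.
by move=> hp hc hl; exact: (xgetPex 0 (is_prox_exists z hp hc hl)).
Qed.

End proximal_map.

Section convex_lsc_functions.
Context {R : realType} {H : hilbertType R}.
Implicit Types (c : R) (h : H -> \bar R).

Lemma proper_ereal_EFin (l : H -> R) : proper_ereal (EFin \o l).
Proof. by split=> [u|]; [rewrite gt_eqF ?ltNyr|exists 0; rewrite lt_eqF ?ltry]. Qed.

Lemma proper_erealZ c h : 0 < c -> proper_ereal h ->
  proper_ereal (fun u => c%:E * h u)%E.
Proof.
move=> c0 hp; split=> [u|].
  by case: (h u) (hp.1 u) => [r| |]//= _; rewrite ?gt0_muley ?lte_fin.
have [u [r hr]] := proper_ereal_exists hp.
by exists u; rewrite hr -EFinM.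
Qed.

Lemma convex_erealZ c h : 0 < c -> proper_ereal h -> convex_ereal h ->
  convex_ereal (fun u => c%:E * h u)%E.
Proof.
move=> c0 hp hc u v a a01.
have [a0 a1] := andP a01.
have cE : (0 <= c%:E)%E by rewrite lee_fin ltW.
apply: le_trans (lee_wpmul2l cE (hc u v a a01)) _.
rewrite le_eqVlt; apply/orP; left; apply/eqP.
case: (h u) (hp.1 u) => [r| |]// _; case: (h v) (hp.1 v) => [s| |]// _.
- by rewrite -!EFinM -!EFinD; congr EFin; ring.
- by rewrite !gt0_muley ?lte_fin ?subr_gt0// -!EFinM !addey// gt0_muley ?lte_fin.
- by rewrite !gt0_muley ?lte_fin ?subr_gt0// -!EFinM !addye// gt0_muley ?lte_fin.
- by rewrite !gt0_muley ?lte_fin ?subr_gt0// !addey// gt0_muley ?lte_fin.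
Qed.

Lemma lsc_erealZ c h : 0 < c -> lower_semicontinuous h ->
  lower_semicontinuous (fun u => c%:E * h u)%E.
Proof.
move=> c0 hl u a ua.
have c0E : (0 < c%:E)%E by rewrite lte_fin.
have aE : a%:E = (c%:E * (c^-1 * a)%:E)%E by rewrite -EFinM mulVKf// gt_eqF.
have [|V uV Vh] := hl u (c^-1 * a).
  by move: ua; rewrite aE lte_pmul2l.
by exists V => // v /Vh; rewrite aE lte_pmul2l.
Qed.

Lemma continuous_lsc (l : H -> R) : continuous (l : H -> R^o) ->
  lower_semicontinuous (EFin \o l).
Proof.
move=> cl u a; rewrite lte_fin => al.
exists [set v | a < l v]; last by move=> v; rewrite /= lte_fin.
by have /cvgr_gt := cl u; exact.
Qed.

Lemma convex_function_ereal (l : H -> R) : convex_function setT l ->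
  convex_ereal (EFin \o l).
Proof.
move=> cl u v a /andP[a0 a1].
have := cl (Itv01 (ltW a0) (ltW a1)) u v (in_setT _) (in_setT _).
by rewrite -!EFinM -EFinD lee_fin.
Qed.

End convex_lsc_functions.

(** * Riesz representation and gradients *)

Section riesz.
Context {R : realType} {H : hilbertType R}.

(* The representer minimizes u |-> |u|^2/2 - l u. *)
Lemma riesz_representation (l : H -> R^o) : linear l -> continuous l ->
  exists v, l = inner v.
Proof.
move=> ll lc; pose h := EFin \o (fun u => - l u).
have hp : proper_ereal h by exact: proper_ereal_EFin.
have hc : convex_ereal h.
  move=> u v a _; rewrite /h /= -!EFinM -EFinD lee_fin.
  rewrite ll (_ : l ((1 - a) *: v) = (1 - a) * l v).
    by rewrite opprD !mulrN.
  have l0 : l 0 = 0.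
    by apply: (addrI (l 0)); have := ll 1 0 0; rewrite !scale1r !addr0 => /esym.
  by rewrite -[_ *: v]addr0 ll l0 addr0.
have hl : lower_semicontinuous h.
  by apply: continuous_lsc => u; apply: cvgN; exact: lc.
have [p pp] := is_prox_exists 0 hp hc hl; exists p; apply/funext => w.
(* The extra square of the strong inequality cancels [|s w|^2 / 2], so the estimate is linear in
   [s]; the values 1 and -1 give equality. *)
have key s : s * l w <= s * inner p w.
  have := is_prox_strong (s *: w + p) hp hc pp.
  rewrite /h /= -!EFinD lee_fin ll -!inner_norm !innerE (innerC w p).
  rewrite /GRing.scale /=; lra.
apply/eqP; rewrite eq_le; have := key 1; have := key (-1).
by rewrite !mul1r !mulN1r lerN2 => -> ->.
Qed.

End riesz.

Section gradient.
Context {R : realType} {H : hilbertType R}.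

Lemma is_diff_quadratic (h : H -> R) (u v : H) (c : R) :
  (forall x, `|h x - h u - inner v (x - u)| <= c * `|x - u| ^+ 2) ->
  is_diff u (h : H -> R^o) (inner v).
Proof.
move=> hq.
have c0 : 0 <= `|c| by [].
pose L := HB.pack_for {linear H -> R^o} (inner v : H -> R^o)
  (@GRing.isLinear.Build R H R^o *:%R (inner v) (@inner_is_linear R H v)).
have cL : continuous (L : H -> R^o) by exact: inner_continuous.
have hL : (h : H -> R^o) \o shift u = cst (h u : R^o) + L +o_ 0 id.
  apply/eqaddoP => _/posnumP[e].
  have e1 : 0 < e%:num / (1 + `|c|) by rewrite divr_gt0// ltr_pwDl.
  near=> w => /=.
  have -> : ((h \o shift u) - (cst (h u) + L)) w =
      h (w + u) - h u - inner v (w + u - u).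
    by rewrite addrK !fctE /= opprD addrA.
  apply: le_trans (hq _) _; rewrite addrK expr2 mulrA ler_wpM2r//.
  have hw : `|w| <= e%:num / (1 + `|c|).
    by near: w; apply: nbhs0_le.
  apply: (@le_trans _ _ ((1 + `|c|) * (e%:num / (1 + `|c|)))).
    apply: le_trans (_ : (1 + `|c|) * `|w| <= _); last first.
      by rewrite ler_wpM2l// addr_ge0.
    by rewrite ler_wpM2r// (le_trans (ler_norm c))// lerDr.
  by rewrite mulrC divfK// gt_eqF// ltr_pwDl.
have dE := diff_unique cL hL.
apply: DiffDef => //; apply/diff_locallyP; split; rewrite dE//.
Unshelve. all: by end_near. Qed.

(** [xget] may return any representative; the differential is unique and a vector is determined by
    its inner products. *)
Lemma gradient_eq (h : H -> R) (u v : H) :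
  is_diff u (h : H -> R^o) (inner v) -> gradient h u = v.
Proof.
move=> hv; have ex : exists v, is_diff u (h : H -> R^o) (inner v) by exists v.
have := xgetPex 0 ex; rewrite -/(gradient h u) /= => hg.
apply: inner_inj; rewrite -(diff_val (is_diff_def := hv)).
by rewrite -(diff_val (is_diff_def := hg)).
Qed.

End gradient.

(** * Moreau envelopes *)

Section moreau.
Context {R : realType} {G : hilbertType R} (g : G -> R) (L mu : R).
Hypothesis g_convex : convex_function setT g.
Hypothesis g_lip : L.-lipschitz (g : G -> R^o).
Hypothesis mu0 : 0 < mu.
Implicit Types u v w p : G.

Lemma lipschitz_le u v : g u - g v <= L * `|u - v|.
Proof. exact: le_trans (ler_norm _) (g_lip (conj I I : (setT `*` setT) (u, v))). Qed.

Lemma lipschitz_continuous_fun : continuous (g : G -> R^o).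
Proof.
apply: (@lipschitz_map_continuous _ _ _ _ L) => u v.
exact: (g_lip (conj I I : (setT `*` setT) (u, v))).
Qed.

Let gmu u : \bar R := (mu%:E * (g u)%:E)%E.

Let gmu_proper : proper_ereal gmu.
Proof. exact: proper_erealZ mu0 (proper_ereal_EFin g). Qed.

Let gmu_convex : convex_ereal gmu.
Proof.
exact: convex_erealZ mu0 (proper_ereal_EFin g) (convex_function_ereal g_convex).
Qed.

Let gmu_lsc : lower_semicontinuous gmu.
Proof. exact: lsc_erealZ mu0 (continuous_lsc lipschitz_continuous_fun). Qed.

(** The primal side of the envelope: [moreau_val] is the value of the infimal convolution at its
    minimizer [moreau_prox], and [moreau_grad] will be both the gradient and the dual vector
    attaining the supremum in [moreau_envelope]. *)
Definition moreau_prox u := prox gmu u.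
Definition moreau_grad u := mu^-1 *: (u - moreau_prox u).
Definition moreau_val u := g (moreau_prox u) + (2 * mu)^-1 * `|u - moreau_prox u| ^+ 2.

Let proxg u v :
  mu * g (moreau_prox u) + 2^-1 * `|moreau_prox u - u| ^+ 2 +
    2^-1 * `|v - moreau_prox u| ^+ 2 <= mu * g v + 2^-1 * `|v - u| ^+ 2.
Proof.
have := is_prox_strong v gmu_proper gmu_convex
  (proxP u gmu_proper gmu_convex gmu_lsc).
by rewrite /gmu -!EFinM -!EFinD lee_fin addrA.
Qed.

Let moreau_residual u : u - moreau_prox u = mu *: moreau_grad u.
Proof. by rewrite /moreau_grad scalerA divff ?scale1r ?gt_eqF. Qed.

(** Triangle inequality and nonexpansiveness of the prox. The constant is crude, but only its
    existence matters: it carries measurability and square integrability through the gradient. *)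
Lemma moreau_grad_lipschitz u v :
  `|moreau_grad u - moreau_grad v| <= 2 / mu * `|u - v|.
Proof.
rewrite /moreau_grad -scalerBr normrZ gtr0_norm ?invr_gt0//.
rewrite -mulrA mulrCA ler_pM2l ?invr_gt0//.
have hprox := is_prox_nonexpansive gmu_proper gmu_convex
  (proxP u gmu_proper gmu_convex gmu_lsc) (proxP v gmu_proper gmu_convex gmu_lsc).
rewrite opprB [X in _ + X]addrC addrACA; apply: le_trans (ler_normD _ _) _.
by rewrite mulr_natl mulr2n lerD2l addrC distrC.
Qed.

Local Opaque moreau_grad.

(** The optimality condition of the prox: the squares in [proxg] combine into a single inner
    product. *)
Lemma moreau_subgradient u v :
  g (moreau_prox u) + inner (moreau_grad u) (v - moreau_prox u) <= g v.
Proof.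
rewrite -(ler_pM2l mu0) mulrDr -innerZl -moreau_residual.
have := proxg u v; rewrite -!inner_norm !innerE.
move: (moreau_prox u) => w.
by rewrite (innerC w u) (innerC v u) (innerC w v); lra.
Qed.

(** Equality case of Fenchel-Young: the subgradient inequality says that the supremum is attained at
    [moreau_prox u]. *)
Lemma fenchel_conj_moreau_grad u :
  fenchel_conj (EFin \o g) (moreau_grad u) =
  (inner (moreau_prox u) (moreau_grad u) - g (moreau_prox u))%:E.
Proof.
apply/eqP; rewrite eq_le; apply/andP; split.
  apply: ge_ereal_sup => _ [v _ <-]; rewrite /= -EFinB lee_fin.
  by have := moreau_subgradient u v; rewrite innerBr !(innerC (moreau_grad u)); lra.
by apply: ereal_sup_ubound; exists (moreau_prox u).
Qed.

Lemma moreau_valE u :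
  moreau_val u = g (moreau_prox u) + mu / 2 * `|moreau_grad u| ^+ 2.
Proof.
rewrite /moreau_val moreau_residual -!inner_norm !innerE; congr (_ + _).
by field; rewrite gt_eqF.
Qed.

(** Strong duality by hand. Testing the conjugate at [moreau_prox u] and using Young with parameter
    [mu] bounds every dual term; [moreau_grad u] attains the bound. *)
Lemma moreau_envelopeE u : moreau_envelope mu (EFin \o g) u = (moreau_val u)%:E.
Proof.
apply/eqP; rewrite eq_le; apply/andP; split.
  apply: ge_ereal_sup => _ [q _ <-].
  have hq : ((inner (moreau_prox u) q - g (moreau_prox u))%:E
      <= fenchel_conj (EFin \o g) q)%E.
    by apply: ereal_sup_ubound; exists (moreau_prox u).
  (* The conjugate may be [+oo], and the dual term is then [-oo]; [hq] excludes [-oo]. *)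
  case: (fenchel_conj (EFin \o g) q) hq => [r| |]//; last first.
    by rewrite addeNy ?addNye ?leNye.
  rewrite -!EFinB !lee_fin /moreau_val => hr.
  have := @inner_young R G mu q (u - moreau_prox u) mu0.
  by rewrite innerC innerBl; lra.
apply: ereal_sup_ubound; exists (moreau_grad u) => //.
rewrite fenchel_conj_moreau_grad -!EFinB moreau_valE; congr EFin.
have -> : inner u (moreau_grad u) =
    inner (moreau_prox u) (moreau_grad u) + mu * `|moreau_grad u| ^+ 2.
  by rewrite -inner_norm -innerZl -moreau_residual -innerDl addrC subrK.
lra.
Qed.

Lemma moreau_val_le u : moreau_val u <= g u.
Proof.
rewrite -(ler_pM2l mu0) /moreau_val mulrDr distrC.
have := proxg u u; rewrite subrr normr0 expr0n /= mulr0 addr0.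
have -> : mu * ((2 * mu)^-1 * `|moreau_prox u - u| ^+ 2) =
    2^-1 * `|moreau_prox u - u| ^+ 2.
  by field; rewrite gt_eqF.
by have := sqr_ge0 `|u - moreau_prox u|; lra.
Qed.

(** With [a = |moreau_grad u|], moving from [u] to the prox point costs at most [mu L a] in [g], of
    which the envelope recovers [mu a^2 / 2]; completing the square gives the constant. *)
Lemma moreau_val_ge u : g u <= moreau_val u + mu * L ^+ 2 / 2.
Proof.
rewrite moreau_valE.
have := lipschitz_le u (moreau_prox u).
rewrite moreau_residual normrZ gtr0_norm//.
have := mulr_ge0 (ltW mu0) (sqr_ge0 (L - `|moreau_grad u|)).
lra.
Qed.

(** The subgradient at [moreau_prox u] is tested at [moreau_prox v]; Young absorbs the offset
    [v - moreau_prox v] into the quadratic part of [moreau_val v]. *)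
Lemma moreau_val_lower u v :
  moreau_val u + inner (moreau_grad u) (v - u) <= moreau_val v.
Proof.
have := moreau_subgradient u (moreau_prox v).
have := @inner_young R G mu (moreau_grad u) (v - moreau_prox v) mu0.
have hu : inner (moreau_grad u) (moreau_prox u) =
    inner (moreau_grad u) u - mu * `|moreau_grad u| ^+ 2.
  by rewrite -inner_norm -innerZr -moreau_residual -innerBr subKr.
by rewrite (moreau_valE u) /moreau_val !innerBr hu; lra.
Qed.

(** [moreau_prox u] is a competitor in the minimization that defines [moreau_val v]; expanding its
    square around [u] gives the three terms. *)
Lemma moreau_val_upper u v :
  moreau_val v <= moreau_val u + inner (moreau_grad u) (v - u)
    + (2 * mu)^-1 * `|v - u| ^+ 2.
Proof.
have nE : `|moreau_prox u - v| ^+ 2 = `|v - u| ^+ 2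
    + 2 * mu * inner (moreau_grad u) (v - u) + mu ^+ 2 * `|moreau_grad u| ^+ 2.
  have -> : moreau_prox u - v = - (v - u + mu *: moreau_grad u).
    by rewrite -moreau_residual addrA subrK opprB.
  rewrite normrN -!inner_norm; move: (moreau_grad u) (v - u) => p z.
  by rewrite !innerE (innerC z p); ring.
rewrite (moreau_valE u) /moreau_val -(ler_pM2l mu0) !mulrDr.
have -> : mu * ((2 * mu)^-1 * `|v - moreau_prox v| ^+ 2) =
    2^-1 * `|moreau_prox v - v| ^+ 2.
  by rewrite distrC; field; rewrite gt_eqF.
have -> : mu * ((2 * mu)^-1 * `|v - u| ^+ 2) = 2^-1 * `|v - u| ^+ 2.
  by field; rewrite gt_eqF.
have := sqr_ge0 `|moreau_prox u - moreau_prox v|.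
by have := proxg v (moreau_prox u); rewrite nE; lra.
Qed.

End moreau.

(** * Operator norm and the gradient of the smoothed composition *)

Section operator_norm.
Context {R : realType} {H G : normedModType R} (K : {linear H -> G}).
Hypothesis K_continuous : continuous K.

(** [opnorm] is a real [sup], which bounds its elements only once the set is known to be bounded;
    continuity at 0 supplies this. *)
Let bounded : exists2 M : R, 0 <= M & forall u, `|K u| <= M * `|u|.
Proof.
have /cvgrPdist_lt/(_ _ (@ltr01 R)) := @K_continuous (0 : H).
move=> /nbhs_ballP[e /= e0 eK].
exists (2 / e); first by rewrite divr_ge0// ltW.
move=> u; have [->|u0] := eqVneq u 0; first by rewrite linear0 !normr0 mulr0.
have nu : 0 < `|u| by rewrite normr_gt0.
have : `|K ((e / (2 * `|u|)) *: u)| < 1.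
  rewrite -normrN -sub0r -[X in X - _](linear0 K).
  apply: eK; rewrite -ball_normE /= sub0r normrN normrZ gtr0_norm.
    by rewrite invfM mulrA mulfVK ?gt_eqF//; lra.
  by rewrite divr_gt0// mulr_gt0.
rewrite linearZ normrZ gtr0_norm ?divr_gt0 ?mulr_gt0// => h.
rewrite -(ler_pM2l (_ : 0 < e / (2 * `|u|))) ?divr_gt0 ?mulr_gt0//.
apply: le_trans (ltW h) _; rewrite le_eqVlt; apply/orP; left; apply/eqP.
by field; rewrite ?gt_eqF.
Qed.

Lemma opnorm_le u : `|K u| <= opnorm K * `|u|.
Proof.
have [->|u0] := eqVneq u 0; first by rewrite linear0 !normr0 mulr0.
have nu : 0 < `|u| by rewrite normr_gt0.
have [M M0 KM] := bounded.
rewrite -ler_pdivrMr// mulrC -[X in X * _]gtr0_norm ?invr_gt0// -normrZ -linearZ.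
apply: ub_le_sup.
  exists M => _ [v /= v1 <-]; apply: le_trans (KM v) _.
  by rewrite -[leRHS]mulr1 ler_wpM2l.
by exists (`|u|^-1 *: u) => //=; rewrite normrZ gtr0_norm ?invr_gt0// mulVf// gt_eqF.
Qed.

Lemma opnorm_gt0 : (exists u, K u != 0) -> 0 < opnorm K.
Proof.
move=> [u Ku]; rewrite ltNge; apply/negP => K0.
have := opnorm_le u; apply/negP; rewrite -ltNge.
by apply: le_lt_trans (_ : 0 < _); rewrite ?normr_gt0// mulr_le0_ge0.
Qed.

End operator_norm.

Section smoothed_gradient.
Context {R : realType} {H G : hilbertType R} (g : G -> R) (L mu : R).
Context (K : {linear H -> G}).
Hypothesis g_convex : convex_function setT g.
Hypothesis g_lip : L.-lipschitz (g : G -> R^o).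
Hypothesis mu0 : 0 < mu.
Hypothesis K_continuous : continuous K.
Implicit Types u v w : H.

Let p u := moreau_grad g mu (K u).

Lemma opnorm_sqr_le u : `|K u| ^+ 2 <= opnorm K ^+ 2 * `|u| ^+ 2.
Proof.
have h := opnorm_le K_continuous u.
by rewrite -exprMn lerXn2r// nnegrE// (le_trans _ h).
Qed.

(** Chain rule without an adjoint: Riesz represents [w |-> inner (p u) (K w)] by some [q], and the
    quadratic bounds on the envelope show that [q] represents the Frechet derivative. This also
    rules out the default value of [gradient]. *)
Lemma smoothed_gradientE u w :
  inner (smoothed_gradient g K mu u) w = inner (p u) (K w).
Proof.
have [q qE] : exists q, (fun w => inner (p u) (K w)) = inner q.
  apply: riesz_representation => [a v z|v].
    by rewrite linearP innerDr innerZr.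
  exact: (@continuous_comp H G R^o K (inner (p u)) v (@K_continuous v)
    (@inner_continuous R G (p u) (K v))).
suff -> : smoothed_gradient g K mu u = q by rewrite -qE.
apply: gradient_eq; apply: (@is_diff_quadratic R H _ u q (opnorm K ^+ 2 / (2 * mu))) => v.
rewrite !(moreau_envelopeE g_convex g_lip mu0) /= -qE /= linearB.
have hl := moreau_val_lower g_convex g_lip mu0 (K u) (K v).
have hu := moreau_val_upper g_convex g_lip mu0 (K u) (K v).
rewrite ger0_norm; last by rewrite /p; lra.
apply: (@le_trans _ _ ((2 * mu)^-1 * `|K v - K u| ^+ 2)); first by rewrite /p; lra.
rewrite [leRHS]mulrAC [leRHS]mulrC ler_pM2l; last by rewrite invr_gt0 mulr_gt0.
by rewrite -linearB opnorm_sqr_le.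
Qed.

Let h u := moreau_val g mu (K u).

Lemma smoothed_lower u v :
  h u + inner (smoothed_gradient g K mu u) (v - u) <= h v.
Proof. by rewrite smoothed_gradientE linearB (moreau_val_lower g_convex g_lip mu0). Qed.

Lemma smoothed_upper u v :
  h v <= h u + inner (smoothed_gradient g K mu u) (v - u)
         + opnorm K ^+ 2 / (2 * mu) * `|v - u| ^+ 2.
Proof.
rewrite smoothed_gradientE linearB.
apply: le_trans (moreau_val_upper g_convex g_lip mu0 (K u) (K v)) _.
rewrite lerD2l mulrAC [leRHS]mulrC ler_pM2l; last by rewrite invr_gt0 mulr_gt0.
by rewrite -linearB opnorm_sqr_le.
Qed.

Lemma smoothed_gradient_lipschitz u v :
  `|smoothed_gradient g K mu u - smoothed_gradient g K mu v|
    <= 2 / mu * opnorm K ^+ 2 * `|u - v|.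
Proof.
set w := smoothed_gradient g K mu u - smoothed_gradient g K mu v.
have [->|w0] := eqVneq `|w| 0.
  by rewrite mulr_ge0// mulr_ge0 ?sqr_ge0// divr_ge0// ltW.
have nw : 0 < `|w| by rewrite lt0r w0 /=.
have k0 : 0 <= opnorm K.
  by have := le_trans (normr_ge0 _) (opnorm_le K_continuous w); rewrite pmulr_lge0.
(* The gradient is known only through inner products, so the difference [w] is tested against itself
   and one factor [|w|] is cancelled. *)
rewrite -(ler_pM2r nw) -expr2 -inner_norm {1}/w innerBl !smoothed_gradientE -innerBl.
apply: le_trans (ler_norm _) _; apply: le_trans (inner_cauchy _ _) _.
have h1 := moreau_grad_lipschitz g_convex g_lip mu0 (K u) (K v).
have h2 := opnorm_le K_continuous w.
have h3 := opnorm_le K_continuous (u - v); rewrite linearB in h3.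
apply: le_trans (ler_pM _ _ h1 h2) _ => //.
rewrite mulrA ler_wpM2r// expr2 -!mulrA ler_wpM2l//.
rewrite ler_wpM2l ?invr_ge0 ?(ltW mu0)// mulrC ler_wpM2l//.
Qed.

End smoothed_gradient.

(** * The proximal gradient step *)

Section proximal_gradient_step.
Context {R : realType} {H G : hilbertType R} (f : H -> \bar R) (g : G -> R).
Context (L mu : R) (K : {linear H -> G}).
Hypothesis f_proper : proper_ereal f.
Hypothesis f_convex : convex_ereal f.
Hypothesis f_lsc : lower_semicontinuous f.
Hypothesis g_convex : convex_function setT g.
Hypothesis g_lip : L.-lipschitz (g : G -> R^o).
Hypothesis mu0 : 0 < mu.
Hypothesis K_continuous : continuous K.
Hypothesis K_neq0 : exists u, K u != 0.
Implicit Types x y z xi : H.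

(** Spelled as [stepsize] unfolds, so that [prox_step] agrees with the iterates by conversion. *)
Let gam : R := 1 / (opnorm K ^+ 2 / mu).

Let k0 : 0 < opnorm K. Proof. exact: opnorm_gt0 K_continuous K_neq0. Qed.

Let gam0 : 0 < gam.
Proof. by rewrite /gam divr_gt0// divr_gt0// exprn_gt0. Qed.

Definition prox_step xi y := prox (fun u => gam%:E * f u)%E (y - gam *: xi).

Let gf_proper : proper_ereal (fun u => gam%:E * f u)%E.
Proof. exact: proper_erealZ. Qed.

Let gf_convex : convex_ereal (fun u => gam%:E * f u)%E.
Proof. exact: convex_erealZ. Qed.

Let gf_lsc : lower_semicontinuous (fun u => gam%:E * f u)%E.
Proof. exact: lsc_erealZ. Qed.

Let grad := smoothed_gradient g K mu.

Lemma prox_step_fin xi y : f (prox_step xi y) \is a fin_num.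
Proof.
have [r] := is_prox_fin gf_proper (proxP (y - gam *: xi) gf_proper gf_convex gf_lsc).
rewrite -/(prox_step xi y).
case: (f (prox_step xi y)) => // ; rewrite ?gt0_muley ?gt0_muleNy// lte_fin//.
Qed.

Lemma prox_step_nonexpansive xi xi' y y' :
  `|prox_step xi y - prox_step xi' y'| <= `|y - gam *: xi - (y' - gam *: xi')|.
Proof.
exact: (is_prox_nonexpansive gf_proper gf_convex
  (proxP _ gf_proper gf_convex gf_lsc) (proxP _ gf_proper gf_convex gf_lsc)).
Qed.

(** Since [1 / gam] is the smoothness constant, the term [|x - y|^2 / 2] of the smooth upper bound
    cancels the one in the prox inequality. The real bound [fz] lets a convexity estimate of [f z]
    be inserted directly. *)
Lemma prox_step_descent xi y z (fz : R) : (f z <= fz%:E)%E ->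
  gam * (fine (f (prox_step xi y)) + g (K (prox_step xi y)) - mu * L ^+ 2 / 2)
    + 2^-1 * `|z - prox_step xi y| ^+ 2 <=
  gam * (fz + g (K z)) + 2^-1 * `|z - y| ^+ 2
    + gam * inner (xi - grad y) (z - prox_step xi y).
Proof.
move=> fzle.
have := is_prox_strong z gf_proper gf_convex
  (proxP (y - gam *: xi) gf_proper gf_convex gf_lsc).
rewrite -/(prox_step xi y) -[f (prox_step xi y)]fineK ?prox_step_fin//.
move: (fine _) => fx; set x := prox_step xi y => h1.
have {h1} : (gam%:E * fx%:E
   + (2^-1 * `|x - (y - gam *: xi)| ^+ 2 + 2^-1 * `|z - x| ^+ 2)%:E
   <= gam%:E * fz%:E + (2^-1 * `|z - (y - gam *: xi)| ^+ 2)%:E)%E.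
  by apply: le_trans h1 _; rewrite leeD2r// lee_wpmul2l// lee_fin ltW.
rewrite -!EFinM -!EFinD lee_fin => h1.
have h2 := smoothed_upper g_convex g_lip mu0 K_continuous y x.
have h3 := smoothed_lower g_convex g_lip mu0 K_continuous y z.
have h4 := moreau_val_ge g_lip mu0 (K x).
have h5 := moreau_val_le g_convex g_lip mu0 (K z).
have h6 : g (K x) - mu * L ^+ 2 / 2 <= g (K z) + inner (grad y) (x - z)
    + (2 * gam)^-1 * `|x - y| ^+ 2.
  have -> : (2 * gam)^-1 = opnorm K ^+ 2 / (2 * mu).
    by rewrite /gam; field; rewrite !gt_eqF.
  move: h2 h3; rewrite -/grad; move: (grad y) => v.
  by rewrite !innerBr; lra.
rewrite -(ler_pM2l gam0) in h6.
have h7 : gam * ((2 * gam)^-1 * `|x - y| ^+ 2) = 2^-1 * `|x - y| ^+ 2.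
  by field; rewrite gt_eqF.
rewrite [leRHS]mulrDr h7 in h6.
move: h1 h6; move: (grad y) (g (K x)) (g (K z)) => v a b.
rewrite -!inner_norm !innerE.
rewrite (innerC y x) (innerC z x) (innerC z y).
rewrite (innerC xi x) (innerC xi y) (innerC xi z).
by rewrite /=; lra.
Qed.

(** The two prox arguments differ by [gam] times the noise, so by nonexpansiveness the two points
    are at most that far apart. *)
Lemma prox_step_noise xi y z :
  inner (xi - grad y) (z - prox_step xi y) <=
  inner (xi - grad y) (z - prox_step (grad y) y) + gam * `|xi - grad y| ^+ 2.
Proof.
rewrite -lerBlDl -innerBr.
have -> : z - prox_step xi y - (z - prox_step (grad y) y) =
    prox_step (grad y) y - prox_step xi y by rewrite opprB addrC addrA subrK.
apply: le_trans (ler_norm _) _; apply: le_trans (inner_cauchy _ _) _.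
have := prox_step_nonexpansive (grad y) xi y y.
rewrite opprD addrACA subrr add0r opprK [X in _ <= `|X|]addrC -scalerBr.
rewrite normrZ gtr0_norm// => h.
by rewrite expr2 mulrCA ler_wpM2l.
Qed.

End proximal_gradient_step.

(** * Telescoping along one trajectory *)

Section pathwise_estimate.
Context {R : realType} {H G : hilbertType R} (f : H -> \bar R) (g : G -> R).
Context (L : R) (mu t rho : nat -> R) (K : {linear H -> G}).
Hypothesis f_proper : proper_ereal f.
Hypothesis f_convex : convex_ereal f.
Hypothesis f_lsc : lower_semicontinuous f.
Hypothesis g_convex : convex_function setT g.
Hypothesis g_lip : L.-lipschitz (g : G -> R^o).
Hypothesis K_continuous : continuous K.
Hypothesis K_neq0 : exists u, K u != 0.
Hypothesis mu_gt0 : forall k, (1 <= k)%N -> 0 < mu k.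
Hypothesis mu_nonincreasing : forall k, (1 <= k)%N -> mu k.+1 <= mu k.
Hypothesis t1 : t 1%N = 1.
Hypothesis t_ge1 : forall k, (2 <= k)%N -> 1 <= t k.
Hypothesis rhoS : forall k, (1 <= k)%N ->
  rho k.+1 = t k ^+ 2 - t k.+1 ^+ 2 + t k.+1.
Hypothesis rho_ge0 : forall k, (1 <= k)%N -> 0 <= rho k.+1.

Local Notation s := (stepsize K mu).
Local Notation grad k := (smoothed_gradient g K (mu k)).
Local Notation step k := (prox_step f (mu k) K).

Context (x0 : H) (x y xi : nat -> H).
Hypothesis yI : y 0%N = x0.
Hypothesis xS : forall k, x k.+1 = step k.+1 (xi k) (y k).
Hypothesis yS : forall k,
  y k.+1 = x k.+1 + ((t k.+1 - 1) / t k.+2) *: (x k.+1 - x k).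
Context (xstar : H).
Hypothesis xstar_opt : forall u, (objective f g K xstar <= objective f g K u)%E.

Definition noise k := xi k - grad k.+1 (y k).
Definition averaged_point k := (1 - (t k.+1)^-1) *: x k + (t k.+1)^-1 *: xstar.
(** The exact gradient is used here on purpose: apart from constants, the direction depends only on
    [x k] and [y k], hence on the past. *)
Definition noise_direction k :=
  averaged_point k - step k.+1 (grad k.+1 (y k)) (y k).
(** Because of [fine] this is the objective gap only where [f] is finite: at every [x k.+1], but
    possibly not at [x 0]. *)
Definition gap u := fine (f u) + g (K u) - (fine (f xstar) + g (K xstar)).

Let muS k : 0 < mu k.+1. Proof. exact: mu_gt0. Qed.

Let tS k : 1 <= t k.+1.
Proof. by case: k => [|k]; [rewrite t1|exact: t_ge1]. Qed.

Let k0 : 0 < opnorm K. Proof. exact: opnorm_gt0 K_continuous K_neq0. Qed.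

Lemma stepsize_gt0 k : 0 < s k.+1.
Proof. by rewrite /stepsize /smoothness divr_gt0// divr_gt0// exprn_gt0. Qed.

Lemma stepsizeE k : s k.+1 = mu k.+1 / opnorm K ^+ 2.
Proof. by rewrite /stepsize /smoothness div1r invf_div. Qed.

Lemma x_fin k : f (x k.+1) \is a fin_num.
Proof. by rewrite xS prox_step_fin. Qed.

Lemma xstar_fin : f xstar \is a fin_num.
Proof.
have [u [r hr]] := proper_ereal_exists f_proper.
have := xstar_opt u; rewrite /objective hr -EFinD.
by case: (f xstar) (f_proper.1 xstar) => //; rewrite addye.
Qed.

Lemma gap_ge0 u : f u \is a fin_num -> 0 <= gap u.
Proof.
move=> fu; have := xstar_opt u; rewrite /objective /gap subr_ge0.
by rewrite -(fineK fu) -(fineK xstar_fin) -!EFinD lee_fin /=.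
Qed.

Let momentum n : H := t n.+1 *: x n.+1 - (t n.+1 - 1) *: x n.

(** [v] is the previous [momentum], or [x0] at the first step, so the base case and the induction
    step share this estimate. The hypothesis on [y n] turns [t (averaged_point - y)] into
    [xstar - v]. *)
Let scaled_step n (v : H) (fz : R) :
  t n.+1 *: y n = v + (t n.+1 - 1) *: x n ->
  (f (averaged_point n) <= fz%:E)%E ->
  s n.+1 * t n.+1 ^+ 2 * (fine (f (x n.+1)) + g (K (x n.+1)))
    + 2^-1 * `|momentum n - xstar| ^+ 2 <=
  s n.+1 * t n.+1 ^+ 2 * (fz + g (K (averaged_point n)))
    + 2^-1 * `|v - xstar| ^+ 2
    + (s n.+1 * t n.+1 ^+ 2 * (mu n.+1 * L ^+ 2 / 2)
       + s n.+1 ^+ 2 * t n.+1 ^+ 2 * `|noise n| ^+ 2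
       + s n.+1 * t n.+1 ^+ 2 * inner (noise n) (noise_direction n)).
Proof.
move=> ty fzle; set T := t n.+1 in ty *.
have T0 : 0 < T by exact: lt_le_trans (tS n).
have Tz : T *: averaged_point n = (T - 1) *: x n + xstar.
  rewrite /averaged_point scalerDr !scalerA mulrBr mulr1 divff ?gt_eqF//.
  by rewrite scale1r.
have dx : T ^+ 2 * `|averaged_point n - x n.+1| ^+ 2 = `|momentum n - xstar| ^+ 2.
  rewrite -exprMn -[X in X * _]gtr0_norm// -normrZ scalerBr Tz -normrN.
  by congr (`|_| ^+ 2); rewrite /momentum -/T opprB opprD addrA.
have dy : T ^+ 2 * `|averaged_point n - y n| ^+ 2 = `|v - xstar| ^+ 2.
  rewrite -exprMn -[X in X * _]gtr0_norm// -normrZ scalerBr Tz ty -normrN.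
  by congr (`|_| ^+ 2); rewrite opprB addrKA.
have := prox_step_descent f_proper f_convex f_lsc g_convex g_lip (muS n)
  K_continuous K_neq0 (xi n) (y n) fzle.
have := prox_step_noise g f_proper f_convex f_lsc (muS n)
  K_continuous K_neq0 (xi n) (y n) (averaged_point n).
rewrite -xS -/(noise n) -/(noise_direction n).
rewrite -/(smoothness K mu n.+1) -/(s n.+1).
rewrite -dx -dy.
move: (inner _ _) (inner _ _) (fine _ + _) (fz + _) => i j a b hn hd.
have c0 : 0 <= s n.+1 * T ^+ 2 by rewrite mulr_ge0 ?sqr_ge0// ltW ?stepsize_gt0.
have := ler_wpM2l c0 hn.
have := ler_wpM2l (sqr_ge0 T) hd.
lra.
Qed.

Lemma pathwise_bound n :
  s n.+1 * t n.+1 ^+ 2 * gap (x n.+1) <=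
  2^-1 * `|x0 - xstar| ^+ 2 + \sum_(0 <= k < n.+1)
    (s k.+1 * t k.+1 ^+ 2 * (mu k.+1 * L ^+ 2 / 2)
     + s k.+1 ^+ 2 * t k.+1 ^+ 2 * `|noise k| ^+ 2
     + s k.+1 * t k.+1 ^+ 2 * inner (noise k) (noise_direction k)).
Proof.
suff : s n.+1 * t n.+1 ^+ 2 * gap (x n.+1)
    + 2^-1 * `|momentum n - xstar| ^+ 2 <=
  2^-1 * `|x0 - xstar| ^+ 2 + \sum_(0 <= k < n.+1)
    (s k.+1 * t k.+1 ^+ 2 * (mu k.+1 * L ^+ 2 / 2)
     + s k.+1 ^+ 2 * t k.+1 ^+ 2 * `|noise k| ^+ 2
     + s k.+1 * t k.+1 ^+ 2 * inner (noise k) (noise_direction k)).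
  by have := sqr_ge0 `|momentum n - xstar|; lra.
elim: n => [|n IHn].
  rewrite big_nat1.
  (* As [t 1 = 1], the starting point gets weight 0, so a value [f x0 = +oo] does no harm. *)
  have avg : averaged_point 0 = xstar.
    by rewrite /averaged_point t1 invr1 subrr scale0r scale1r add0r.
  have := @scaled_step 0 x0 (fine (f xstar)).
  rewrite avg t1 subrr scale0r scale1r addr0 yI => /(_ erefl).
  by rewrite fineK ?xstar_fin// => /(_ (lexx _)); rewrite /gap; lra.
rewrite big_nat_recr//=; set S := \sum_(0 <= k < n.+1) _ in IHn *.
have T1 := tS n.+1; have s0 := stepsize_gt0 n.+1.
have T0 : 0 < t n.+2 by exact: lt_le_trans T1.
have gx := gap_ge0 (x_fin n).
(* Nonnegativity of [rho] compares the [t] factors and monotonicity of [mu] the step sizes; the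
   inequality is later multiplied by the nonnegative gap. *)
have coef : s n.+2 * (t n.+2 ^+ 2 - t n.+2) <= s n.+1 * t n.+1 ^+ 2.
  apply: (@le_trans _ _ (s n.+2 * t n.+1 ^+ 2)).
    rewrite ler_pM2l//; have := @rho_ge0 n.+1 isT; rewrite rhoS//; lra.
  rewrite ler_wpM2r ?sqr_ge0// !stepsizeE ler_pM2r ?invr_gt0 ?exprn_gt0//.
  exact: mu_nonincreasing.
have ty : t n.+2 *: y n.+1 = momentum n + (t n.+2 - 1) *: x n.+1.
  rewrite yS scalerDr scalerA mulrCA divff ?gt_eqF// mulr1 /momentum.
  rewrite scalerBr addrA -scalerDl addrAC -scalerDl.
  by congr (_ *: _ - _); ring.
pose a := (t n.+2)^-1.
have a0 : 0 < a by rewrite invr_gt0.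
have avgE : averaged_point n.+1 = (1 - a) *: x n.+1 + a *: xstar by [].
have f_avg : (f (averaged_point n.+1) <=
   ((1 - a) * fine (f (x n.+1)) + a * fine (f xstar))%:E)%E.
  (* [convex_ereal] covers only weights strictly between 0 and 1, so [t n.+2 = 1] is treated
     apart. *)
  have [a1|a1] := eqVneq a 1.
    by rewrite avgE a1 subrr scale0r mul0r !add0r scale1r mul1r fineK ?xstar_fin.
  have a01 : 0 < 1 - a < 1.
    by rewrite subr_gt0 lt_neqAle a1 invf_le1// T1/=; lra.
  have := f_convex (x n.+1) xstar a01; rewrite subKr -avgE.
  by rewrite -(fineK (x_fin n)) -(fineK xstar_fin) -!EFinM -EFinD.
have g_avg : g (K (averaged_point n.+1)) <=
    (1 - a) * g (K (x n.+1)) + a * g (K xstar).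
  have [a1|a1] := eqVneq a 1.
    by rewrite avgE a1 subrr scale0r mul0r !add0r scale1r mul1r.
  have a01 : 0 < 1 - a < 1.
    by rewrite subr_gt0 lt_neqAle a1 invf_le1// T1/=; lra.
  have := convex_function_ereal g_convex (K (x n.+1)) (K xstar) a01; rewrite subKr.
  by rewrite -!EFinM -EFinD lee_fin avgE linearD !linearZ.
have := scaled_step ty f_avg.
have Tgap : t n.+2 ^+ 2 * ((1 - a) * gap (x n.+1)) =
    (t n.+2 ^+ 2 - t n.+2) * gap (x n.+1).
  by rewrite /a; field; rewrite gt_eqF.
have := ler_wpM2r gx coef.
have := ler_wpM2l (ltW (mulr_gt0 s0 (exprn_gt0 2 T0))) g_avg.
rewrite -[s n.+2 * _ * gap (x n.+1)]mulrA -Tgap.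
move: IHn; rewrite /gap; clearbody a S; lra.
Qed.

End pathwise_estimate.

(** * Strong measurability and integration *)

Section strong_measurability.
Context {R : realType} {d : measure_display} {T : measurableType d}.

Local Notation simple := (simple_wrt (@measurable d T)).
Local Notation strong := (strongly_measurable (@measurable d T)).

Lemma simple_preimage (V : normedModType R) (s : T -> V) (B : set V) :
  simple s -> measurable (s @^-1` B).
Proof.
move=> [fs ms].
have -> : s @^-1` B = \bigcup_(v in range s `&` B) s @^-1` [set v].
  apply/seteqP; split=> [w Bw|w [v [_ Bv] /= ->]//].
  by exists (s w) => //; split=> //; exists w.
by apply: fin_bigcup_measurable => [|v _]; [exact: finite_setIl|exact: ms].
Qed.

Lemma simple_comp2 (V V' W : normedModType R) (phi : V -> V' -> W)
    (s : T -> V) (s' : T -> V') :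
  simple s -> simple s' -> simple (fun w => phi (s w) (s' w)).
Proof.
move=> ss ss'; split.
  apply: sub_finite_set (finite_image2 phi ss.1 ss'.1).
  by move=> _ [w _ <-]; exists (s w); [exists w|exists (s' w); [exists w|]].
move=> u.
have -> : (fun w => phi (s w) (s' w)) @^-1` [set u] =
    \bigcup_(v in range s) (s @^-1` [set v] `&` s' @^-1` [set v' | phi v v' = u]).
  apply/seteqP; split=> [w /= wu|w [v _ [/= <-]]//].
  by exists (s w); [exists w|].
apply: fin_bigcup_measurable => [|v _]; first exact: ss.1.
by apply: measurableI; exact: simple_preimage.
Qed.

Lemma simple_cst (V : normedModType R) (v : V) : simple (cst v).
Proof.
split=> [|u].
  by apply: sub_finite_set (finite_set1 v) => _ [w _ <-].
have [->|vu] := pselect (v = u).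
  by rewrite (_ : _ @^-1` _ = setT)//; apply/seteqP; split.
by rewrite (_ : _ @^-1` _ = set0)//; apply/seteqP; split.
Qed.

Lemma simple_if (V : normedModType R) (A : set T) (v : V) (s : T -> V) :
  measurable A -> simple s -> simple (fun w => if w \in A then v else s w).
Proof.
move=> mA ss; split.
  have fv : finite_set (v |` range s) by rewrite finite_setU; split=> //; exact: ss.1.
  apply: sub_finite_set fv => _ [w _ <-]; case: ifP => _; first by left.
  by right; exists w.
move=> u.
have -> : (fun w => if w \in A then v else s w) @^-1` [set u] =
    (A `&` cst v @^-1` [set u]) `|` (~` A `&` s @^-1` [set u]).
  apply/seteqP; split=> [w /=|w /=].
    case: ifPn => [/set_mem Aw|/negP Aw] wu; [by left|right].
    by split=> // ?; apply: Aw; rewrite inE.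
  by move=> [[Aw <-]|[Aw <-]]; [rewrite mem_set|rewrite memNset].
apply: measurableU; apply: measurableI => //; first exact: (simple_cst v).2.
  exact: measurableC.
exact: ss.2.
Qed.

Lemma strong_comp2 (V V' W : normedModType R) (phi : V -> V' -> W)
    (X : T -> V) (X' : T -> V') :
  (forall (u : nat -> V) (u' : nat -> V') a a',
     u n @[n --> \oo] --> a -> u' n @[n --> \oo] --> a' ->
     phi (u n) (u' n) @[n --> \oo] --> phi a a') ->
  strong X -> strong X' -> strong (fun w => phi (X w) (X' w)).
Proof.
move=> cphi [s [ss sX]] [s' [ss' sX']].
exists (fun n w => phi (s n w) (s' n w)); split=> [n|w].
  exact: simple_comp2.
exact: cphi.
Qed.

Lemma strong_cst (V : normedModType R) (v : V) : strong (cst v).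
Proof. by exists (fun=> cst v); split=> [_|w]; [exact: simple_cst|exact: cvg_cst]. Qed.

Lemma strong_comp (V W : normedModType R) (phi : V -> W) (X : T -> V) :
  continuous phi -> strong X -> strong (fun w => phi (X w)).
Proof.
move=> cphi sX; apply: (@strong_comp2 V V W (fun u _ => phi u) X X) => //.
by move=> u _ a _ ua _; exact: (cvg_comp _ _ ua (cphi a)).
Qed.

Lemma strongD (V : normedModType R) (X Y : T -> V) :
  strong X -> strong Y -> strong (fun w => X w + Y w).
Proof. by apply: (@strong_comp2 V V V +%R) => u u' a a' ua ua'; exact: cvgD. Qed.

Lemma strongZ (V : normedModType R) (c : R) (X : T -> V) :
  strong X -> strong (fun w => c *: X w).
Proof. by apply: (@strong_comp V V ( *:%R c)); exact: scaler_continuous. Qed.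

Lemma strongB (V : normedModType R) (X Y : T -> V) :
  strong X -> strong Y -> strong (fun w => X w - Y w).
Proof.
by apply: (@strong_comp2 V V V (fun x y => x - y)) => u u' a a' ua ua'; exact: cvgB.
Qed.

Lemma strong_inner (H : hilbertType R) (X Y : T -> H) :
  strong X -> strong Y -> strong (fun w => inner (X w) (Y w) : R^o).
Proof.
apply: (@strong_comp2 H H R^o inner) => u v a b ua vb.
(* Polarization reduces joint continuity of the inner product to continuity of the norm. *)
have polar x y : inner x y = 4^-1 * (`|x + y| ^+ 2 - `|x - y| ^+ 2).
  by rewrite -!inner_norm !innerE (innerC y x); field.
under eq_fun do rewrite polar; rewrite polar.
have h1 : `|u n + v n| @[n --> \oo] --> `|a + b| by apply: cvg_norm; exact: cvgD.
have h2 : `|u n - v n| @[n --> \oo] --> `|a - b| by apply: cvg_norm; exact: cvgB.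
by apply: cvgM; [exact: cvg_cst|exact: (cvgB (cvgM h1 h1) (cvgM h2 h2))].
Qed.

Lemma strong_norm (V : normedModType R) (X : T -> V) :
  strong X -> strong (fun w => `|X w| : R^o).
Proof. by apply: (@strong_comp V R^o (fun v => `|v|)); exact: norm_continuous. Qed.

Lemma strong_measurable_fun (X : T -> R) :
  strong (X : T -> R^o) -> measurable_fun setT X.
Proof.
move=> [s [ss sX]]; apply: (measurable_fun_cvg (h := s)) => [n _ B _|w _].
  by rewrite setTI; exact: simple_preimage (ss n).
exact: sX.
Qed.

Lemma strong_open_preimage (V : normedModType R) (X : T -> V) (U : set V) :
  strong X -> open U -> measurable (X @^-1` U).
Proof.
move=> [s [ss sX]] oU.
pose Um m := [set v | ball v m.+1%:R^-1 `<=` U].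
have -> : X @^-1` U =
    \bigcup_m \bigcup_n0 \bigcap_(n in [set n | (n0 <= n)%N]) s n @^-1` Um m.
  apply/seteqP; split=> w /=.
    move=> Uw; have /nbhs_ballP[e /= e0 eU] : nbhs (X w) U by exact: open_nbhs_nbhs.
    have e20 : 0 < e / 2 by rewrite divr_gt0.
    have [m _ /(_ m (leqnn m)) /= hm] := near_infty_natSinv_lt (PosNum e20).
    have /cvgrPdist_lt/(_ _ e20)[n0 _ hn0] := sX w.
    exists m => //; exists n0 => // n /= n0n v; rewrite -ball_normE /= => nv.
    apply: eU; rewrite -ball_normE /= (splitr e).
    apply: le_lt_trans (ler_distD (s n w) _ _) _.
    by apply: ltrD; [exact: hn0|exact: lt_trans nv hm].
  move=> [m _ [n0 _ hn]].
  have m0 : 0 < (m.+1%:R^-1 : R) by rewrite invr_gt0.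
  have /cvgrPdist_lt/(_ _ m0)[n1 _ hn1] := sX w.
  apply: (hn (maxn n0 n1)); first by rewrite /= leq_maxl.
  by rewrite -ball_normE /= distrC; apply: hn1; rewrite /= leq_maxr.
apply: bigcup_measurable => m _; apply: bigcup_measurable => n0 _.
apply: bigcap_measurable; first by exists n0 => /=.
by move=> n _; exact: simple_preimage (ss n).
Qed.

End strong_measurability.


Section nearest_point_approximation.
Context {R : realType} {V : normedModType R} {T : Type}.
Context (e : nat -> V) (X : T -> V).

(** Picks a point nearest to [X w] among 0 and the first [n] points of [e]. Keeping 0 as a candidate
    forces the error below [|X w|], hence the domination by [2 |X w|]. *)
Fixpoint nearest n w : V := if n is n'.+1 then
  if `|e n' - X w| < `|nearest n' w - X w| then e n' else nearest n' w
  else 0.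

Lemma nearest_le n w : `|nearest n w - X w| <= `|X w|.
Proof.
elim: n => [|n IHn] /=; first by rewrite sub0r normrN.
by case: ifPn => // /ltW h; exact: le_trans h IHn.
Qed.

Lemma nearest_norm n w : `|nearest n w| <= 2 * `|X w|.
Proof.
rewrite -[nearest n w](subrK (X w)); apply: le_trans (ler_normD _ _) _.
by have := nearest_le n w; lra.
Qed.

Lemma nearest_opt n i w : (i < n)%N -> `|nearest n w - X w| <= `|e i - X w|.
Proof.
elim: n => // n IHn; rewrite ltnS leq_eqVlt => /predU1P[->|/IHn h] /=.
  by case: ifPn => //; rewrite -leNgt.
by case: ifPn => // /ltW h'; exact: le_trans h' h.
Qed.

Lemma nearest_cvg w : (forall eps, 0 < eps -> exists i, `|e i - X w| < eps) ->
  nearest n w @[n --> \oo] --> X w.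
Proof.
move=> ex; apply/cvgrPdist_lt => eps eps0.
have [i hi] := ex _ eps0; near=> n; rewrite distrC.
by apply: le_lt_trans hi; apply: nearest_opt; near: n; exists i.+1.
Unshelve. all: by end_near. Qed.

End nearest_point_approximation.

(* Strong measurability for a smaller sigma-algebra: the range stays separable,
   so only preimages of open sets have to be checked. *)
Lemma strong_dominated_approximation {R : realType} {V : normedModType R}
    {d d' : measure_display} {T : measurableType d} {T' : measurableType d'}
    (j : T' -> T) (X : T -> V) :
  strongly_measurable (@measurable d T) X ->
  (forall U, open U -> measurable ((X \o j) @^-1` U)) ->
  exists s : nat -> T' -> V,
    [/\ forall n, simple_wrt (@measurable d' T') (s n),
        forall w, s n w @[n --> \oo] --> X (j w) &
        forall n w, `|s n w| <= 2 * `|X (j w)|].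
Proof.
move=> [s [ss sX]] mX.
(* The values of all the [s n] form a countable set whose closure contains the range of [X]. *)
have [e he] : exists e : nat -> V, forall n w, exists i, s n w = e i.
  have cD : countable (\bigcup_n range (s n)).
    by apply: bigcup_countable => // n _; exact: finite_set_countable (ss n).1.
  have [eq0|] := eqVneq (\bigcup_n range (s n)) set0.
    exists (fun=> 0) => n w; suff : set0 (s n w) by [].
    by rewrite -eq0; exists n => //; exists w.
  move: cD => /pfcard_geP[->|[e]]; first by rewrite eqxx.
  move=> _; exists e => n w.
  have /(@surj _ _ _ _ e)[i _ <-] : (\bigcup_n range (s n)) (s n w).
    by exists n => //; exists w.
  by exists i.
exists (nearest e (X \o j)); split=> [n|w|n w].
- elim: n => [|n IHn] /=; first exact: simple_cst.
  pose A := [set w | `|e n - X (j w)| < `|nearest e (X \o j) n w - X (j w)|].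
  have -> : (fun w => if `|e n - X (j w)| < `|nearest e (X \o j) n w - X (j w)|
      then e n else nearest e (X \o j) n w) =
    (fun w => if w \in A then e n else nearest e (X \o j) n w).
    apply/funext => w; congr (if _ then _ else _).
    by apply/idP/idP => [h|/set_mem//]; rewrite inE.
  apply: simple_if => //.
  (* Once the current nearest value [v] is fixed, the new candidate wins exactly when [X] lies in an
     open set. *)
  have -> : A = \bigcup_(v in range (nearest e (X \o j) n))
      (nearest e (X \o j) n @^-1` [set v] `&`
       (X \o j) @^-1` [set x | `|e n - x| < `|v - x|]).
    apply/seteqP; split=> [w Aw|w [v _ [/= <-]]//].
    by exists (nearest e (X \o j) n w); [exists w|split].
  apply: fin_bigcup_measurable => [|v _]; first exact: IHn.1.
  apply: measurableI; first exact: IHn.2.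
  apply: mX; rewrite (_ : [set x | _] =
    (fun x => `|v - x| - `|e n - x|) @^-1` [set r | 0 < r]).
    apply: open_comp; last exact: open_gt.
    move=> x _; apply: (@cvgB _ R^o).
      by apply: cvg_norm; apply: cvgB; [exact: cvg_cst|exact: cvg_id].
    by apply: cvg_norm; apply: cvgB; [exact: cvg_cst|exact: cvg_id].
  by apply/seteqP; split=> x /=; rewrite subr_gt0.
- apply: nearest_cvg => eps eps0.
  have /cvgrPdist_lt/(_ _ eps0)[n _ /(_ n (leqnn n))] := sX (j w).
  by have [i ->] := he n (j w); rewrite distrC; exists i.
- exact: nearest_norm.
Qed.

(** * Integrals of simple maps and Bochner integrals *)

Section simple_integrals.
Context {R : realType} {V : normedModType R}.
Context {d : measure_display} {T : measurableType d} (P : probability T R).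

(** [F] may depend on [w] to serve two uses: [inner v u] for integrals of simple maps, and
    [inner (xi w - v w) u] for the noise against a simple direction. *)
Lemma integral_simple_decomp (A : set T) (s : T -> V) (r : seq V) (F : T -> V -> R) :
  measurable A -> simple_wrt measurable s -> uniq r -> range s `<=` [set` r] ->
  (forall u, P.-integrable A (fun w => (F w u)%:E)) ->
  P.-integrable A (fun w => (F w (s w))%:E) /\
  (\int[P]_(w in A) (F w (s w))%:E =
   \sum_(u <- r) \int[P]_(w in A `&` s @^-1` [set u]) (F w u)%:E)%E.
Proof.
move=> mA ss ur rs iF.
pose h u := (fun w => (F w u)%:E) \_ (s @^-1` [set u]).
have hE w : (F w (s w))%:E = (\sum_(u <- r) h u w)%E.
  rewrite (bigD1_seq (s w))//=; last by apply: rs; exists w.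
  rewrite big1 ?adde0 => [|u us].
    by rewrite /h patchE mem_set.
  rewrite /h patchE memNset//= => sw; by move: us; rewrite sw eqxx.
have ih u : P.-integrable A (h u).
  apply: le_integrable (iF u) => //.
    apply/measurable_restrict => //; first exact: ss.2.
    apply: (@measurable_funS _ _ _ _ A) => //.
    exact: measurable_int (iF u).
  move=> w _; rewrite /h patchE; case: ifPn => // _; by rewrite abse0.
split.
  rewrite (_ : (fun w => _) = (fun w => \sum_(u <- r) h u w)%E); last exact/funext.
  exact: integrable_sum.
rewrite (eq_integral (fun w => \sum_(u <- r) h u w)%E); last by move=> w _; exact: hE.
rewrite integral_sum//; apply: eq_bigr => u _.
by rewrite integral_mkcondr.
Qed.

End simple_integrals.


Section bochner_inner.
Context {R : realType} {H : hilbertType R}.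
Context {d : measure_display} {T : measurableType d} (P : probability T R).

Local Notation strong := (strongly_measurable (@measurable d T)).

Lemma strong_measurable_EFin (X : T -> R) (A : set T) :
  strong (X : T -> R^o) -> measurable_fun A (EFin \o X).
Proof.
by move=> sX; apply/measurable_EFinP/measurable_funTS; exact: strong_measurable_fun.
Qed.

Lemma simple_strong (s : T -> H) : simple_wrt measurable s -> strong s.
Proof. by move=> ss; exists (fun=> s); split=> // w; exact: cvg_cst. Qed.

Lemma integral_inner_simple (A : set T) (s : T -> H) (u : H) :
  measurable A -> simple_wrt measurable s ->
  P.-integrable A (fun w => (inner (s w) u)%:E) /\
  (\int[P]_(w in A) (inner (s w) u)%:E = (inner (simple_integral P A s) u)%:E)%E.
Proof.
move=> mA ss; pose r : seq H := finmap.enum_fset (fset_set (range s)).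
have icst v : P.-integrable A (fun w => (inner v u)%:E).
  exact: finite_measure_integrable_cst.
have [] := @integral_simple_decomp _ _ _ _ P A s r (fun _ v => inner v u) mA ss _ _ icst.
- exact: finmap.fset_uniq.
- by move=> v vs; rewrite /= in_fset_set ?mem_set//; exact: ss.1.
move=> ii ->; split=> //.
rewrite /simple_integral fsbig_finite /=; last exact: ss.1.
rewrite (big_morph (fun v => inner v u) (id1 := 0) (op1 := +%R)); last 2 first.
- by move=> v w; exact: innerDl.
- exact: inner0l.
rewrite -sumEFin; apply: eq_bigr => v _.
rewrite integral_cst; last by apply: measurableI => //; exact: ss.2.
rewrite innerZl mulrC EFinM fineK// fin_num_measure//.
by apply: measurableI => //; exact: ss.2.
Qed.

Lemma integrable_inner (A : set T) (X : T -> H) (u : H) : measurable A ->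
  strong X -> (\int[P]_(w in A) `|X w|%:E < +oo)%E ->
  P.-integrable A (fun w => (inner (X w) u)%:E).
Proof.
move=> mA sX iX.
have iN : P.-integrable A (fun w => (`|u|%:E * `|X w|%:E)%E).
  apply: integrableZl => //; apply/integrableP; split.
    exact: (@strong_measurable_EFin (fun w => `|X w|) A (strong_norm sX)).
  by under eq_integral do rewrite gee0_abs ?lee_fin//.
apply: le_integrable iN => //.
  exact: (@strong_measurable_EFin (fun w => inner (X w) u) A
    (strong_inner sX (strong_cst u))).
move=> w _; rewrite -EFinM /= lee_fin mulrC [leRHS]ger0_norm ?mulr_ge0//.
exact: inner_cauchy.
Qed.

(** Turns vector integrals into Lebesgue integrals. Replacing [X] by [s n] costs at most [|u|] times
    the L1 error, so both sides are the limit of the same sequence. *)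
Lemma integral_inner_bochner (A : set T) (X : T -> H) (b u : H) : measurable A ->
  strong X -> (\int[P]_(w in A) `|X w|%:E < +oo)%E ->
  is_bochner_integral P A X b ->
  (\int[P]_(w in A) (inner (X w) u)%:E = (inner b u)%:E)%E.
Proof.
move=> mA sX iX [s [ss sXn sb]].
have iXu := integrable_inner u mA sX iX.
set I := (\int[P]_(w in A) _)%E.
have Ifin : I \is a fin_num by exact: integrable_fin_num.
have bound n : (`|I - (inner (simple_integral P A (s n)) u)%:E| <=
    `|u|%:E * \int[P]_(w in A) `|X w - s n w|%:E)%E.
  have [is_ isE] := integral_inner_simple u mA (ss n).
  have mXs : measurable_fun A (fun w => `|X w - s n w|%:E).
    exact: (@strong_measurable_EFin (fun w => `|X w - s n w|) A
      (strong_norm (strongB sX (simple_strong (ss n))))).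
  rewrite -isE -integralB//.
  apply: le_trans (le_abse_integral _ _ _) _ => //.
    by apply: emeasurable_funB; apply: measurable_int; [exact: iXu|exact: is_].
  rewrite -ge0_integralZl//.
  apply: ge0_le_integral => //.
  - apply: measurableT_comp => //.
    by apply: emeasurable_funB; apply: measurable_int; [exact: iXu|exact: is_].
  - exact: measurable_funeM.
  - by move=> w _; rewrite -EFinB -EFinM /= lee_fin -innerBl mulrC inner_cauchy.
have lim0 : (`|u|%:E * \int[P]_(w in A) `|X w - s n w|%:E)%E @[n --> \oo] --> 0%E.
  by rewrite -(mule0 `|u|%:E); apply: cvgeZl.
rewrite -(fineK Ifin); congr EFin.
have c1 : inner (simple_integral P A (s n)) u @[n --> \oo] --> inner b u.
  under eq_fun do rewrite innerC; rewrite innerC.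
  exact: (cvg_comp _ _ sb (@inner_continuous R H u b)).
have c2 : inner (simple_integral P A (s n)) u @[n --> \oo] --> fine I.
  apply/cvgrPdist_le => eps eps0.
  have /fine_cvgP[lfin /cvgrPdist_le/(_ _ eps0) l0] := lim0.
  near=> n.
  have bfin : (`|u|%:E * \int[P]_(w in A) `|X w - s n w|%:E)%E \is a fin_num.
    by near: n; exact: lfin.
  have bl : `|0 - fine (`|u|%:E * \int[P]_(w in A) `|X w - s n w|%:E)%E| <= eps.
    by near: n; exact: l0.
  have := bound n; rewrite -{1}(fineK Ifin) -EFinB /= -(fineK bfin) lee_fin.
  by move=> /le_trans; apply; apply: le_trans bl; rewrite sub0r normrN ler_norm.
rewrite -[LHS](cvg_lim (@Rhausdorff R) c2).
exact: (cvg_lim (@Rhausdorff R) c1).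
Unshelve. all: by end_near. Qed.

End bochner_inner.

Section square_integrable.
Context {R : realType} {d : measure_display} {T : measurableType d}.
Context (P : probability T R).

Local Notation strong := (strongly_measurable (@measurable d T)).

Definition square_integrable (V : normedModType R) (X : T -> V) :=
  strong X /\ (\int[P]_w (`|X w| ^+ 2)%:E < +oo)%E.

Lemma square_integrableP (V : normedModType R) (X : T -> V) :
  square_integrable X ->
  strong X /\ P.-integrable setT (fun w => (`|X w| ^+ 2)%:E).
Proof.
move=> [sX iX]; split=> //; apply/integrableP; split.
  have mN : measurable_fun setT (fun w => `|X w|).
    exact: strong_measurable_fun (strong_norm sX).
  by apply/measurable_EFinP; exact: measurable_funX.
by under eq_integral do rewrite gee0_abs ?lee_fin ?sqr_ge0//.
Qed.

Lemma le_square_integrable (V V1 V2 : normedModType R) (X : T -> V)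
    (X1 : T -> V1) (X2 : T -> V2) (a b c : R) :
  strong X -> square_integrable X1 -> square_integrable X2 ->
  (forall w, `|X w| ^+ 2 <= a + b * `|X1 w| ^+ 2 + c * `|X2 w| ^+ 2) ->
  square_integrable X.
Proof.
move=> sX /square_integrableP[_ i1] /square_integrableP[_ i2] le; split=> //.
have mN : measurable_fun setT (fun w => (`|X w| ^+ 2)%:E).
  have mN : measurable_fun setT (fun w => `|X w|).
    exact: strong_measurable_fun (strong_norm sX).
  by apply/measurable_EFinP; exact: measurable_funX.
have iB : P.-integrable setT
    (fun w => (a%:E + b%:E * (`|X1 w| ^+ 2)%:E + c%:E * (`|X2 w| ^+ 2)%:E)%E).
  apply: integrableD => //; last exact: integrableZl.
  apply: integrableD => //; last exact: integrableZl.
  exact: finite_measure_integrable_cst.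
have iN : P.-integrable setT (fun w => (`|X w| ^+ 2)%:E).
  apply: le_integrable iB => // w _.
  rewrite -!EFinM -!EFinD /= lee_fin ger0_norm ?sqr_ge0//.
  by apply: le_trans (le w) _; rewrite ler_norm.
have /integrableP[_] := iN.
by under eq_integral do rewrite gee0_abs ?lee_fin ?sqr_ge0//.
Qed.

Lemma square_integrable_cst (V : normedModType R) (v : V) : square_integrable (cst v).
Proof.
split; first exact: strong_cst.
have /integrableP[_] := finite_measure_integrable_cst P (`|v| ^+ 2) measurableT.
by under eq_integral do rewrite gee0_abs ?lee_fin ?sqr_ge0//.
Qed.

Lemma square_integrableD (V : normedModType R) (X Y : T -> V) :
  square_integrable X -> square_integrable Y -> square_integrable (fun w => X w + Y w).
Proof.
move=> qX qY; apply: (@le_square_integrable _ _ _ _ _ _ 0 2 2 _ qX qY).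
  exact: strongD qX.1 qY.1.
move=> w; have h : `|X w + Y w| ^+ 2 <= (`|X w| + `|Y w|) ^+ 2.
  by rewrite lerXn2r ?nnegrE ?addr_ge0// ler_normD.
by apply: le_trans h _; have := sqr_ge0 (`|X w| - `|Y w|); lra.
Qed.

Lemma square_integrableZ (V : normedModType R) (k : R) (X : T -> V) :
  square_integrable X -> square_integrable (fun w => k *: X w).
Proof.
move=> qX; apply: (@le_square_integrable _ _ _ _ _ _ 0 (k ^+ 2) 0 _ qX qX).
  exact: strongZ qX.1.
by move=> w; rewrite normrZ exprMn -normrX ger0_norm ?sqr_ge0// add0r mul0r addr0.
Qed.

Lemma square_integrableB (V : normedModType R) (X Y : T -> V) :
  square_integrable X -> square_integrable Y -> square_integrable (fun w => X w - Y w).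
Proof.
move=> qX /(square_integrableZ (-1)) /(square_integrableD qX).
by under eq_fun do rewrite scaleN1r.
Qed.

Lemma square_integrable_lipschitz (V W : normedModType R) (phi : V -> W) (c : R)
    (X : T -> V) :
  (forall u v, `|phi u - phi v| <= c * `|u - v|) ->
  square_integrable X -> square_integrable (fun w => phi (X w)).
Proof.
move=> lphi qX.
apply: (@le_square_integrable _ _ _ _ _ _ (2 * `|phi 0| ^+ 2) (2 * c ^+ 2) 0 _ qX qX).
  exact: strong_comp (lipschitz_map_continuous lphi) qX.1.
move=> w; rewrite mul0r addr0.
have h0 : `|phi (X w)| <= c * `|X w| + `|phi 0|.
  rewrite -[phi (X w)](subrK (phi 0)); apply: le_trans (ler_normD _ _) _.
  by rewrite lerD2r; have := lphi (X w) 0; rewrite subr0.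
have h1 : `|phi (X w)| ^+ 2 <= (c * `|X w| + `|phi 0|) ^+ 2.
  by rewrite lerXn2r ?nnegrE// (le_trans _ h0).
by apply: le_trans h1 _; have := sqr_ge0 (c * `|X w| - `|phi 0|); lra.
Qed.

Lemma integrable_inner_prod (H : hilbertType R) (X Y : T -> H) :
  square_integrable X -> square_integrable Y ->
  P.-integrable setT (fun w => (inner (X w) (Y w))%:E).
Proof.
move=> qX qY.
have iB : P.-integrable setT (fun w => ((`|X w| ^+ 2)%:E + (`|Y w| ^+ 2)%:E)%E).
  apply: integrableD => //; first exact: (square_integrableP qX).2.
  exact: (square_integrableP qY).2.
apply: le_integrable iB => // [|w _].
  apply/measurable_EFinP; exact: strong_measurable_fun (strong_inner qX.1 qY.1).
rewrite -EFinD /= lee_fin [leRHS]ger0_norm ?addr_ge0 ?sqr_ge0//.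
apply: le_trans (inner_cauchy _ _) _.
have := sqr_ge0 (`|X w| - `|Y w|); have := sqr_ge0 `|X w|; have := sqr_ge0 `|Y w|.
by lra.
Qed.

End square_integrable.

(** * Conditional expectation and orthogonality *)

Section conditional_orthogonality.
Context {R : realType} {H : hilbertType R}.
Context {d : measure_display} {T : measurableType d} (P : probability T R).
Context (G : set_system T).
Hypothesis G_measurable : forall A, <<s G >> A -> measurable A.

(** On each event [xi] and the version [Y] have the same vector integral, and [v] equals [Y] almost
    everywhere. *)
Lemma cond_mean_eq_integral (xi v : T -> H) (B : set T) (u : H) :
  cond_mean_eq P <<s G >> xi v ->
  square_integrable P (fun w => xi w - v w) -> <<s G >> B ->
  (\int[P]_(w in B) (inner (xi w - v w) u)%:E = 0)%E.
Proof.
move=> [Y [[sxi ixi] [sY iY] _ eqB] aeY] qe GB.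
have mB := G_measurable GB.
have [b bxi bY] := eqB _ GB.
have subT (X : T -> H) : strongly_measurable measurable X ->
    (\int[P]_w `|X w|%:E < +oo)%E -> (\int[P]_(w in B) `|X w|%:E < +oo)%E.
  move=> sX; apply: le_lt_trans; apply: ge0_subset_integral => //.
  exact: (@strong_measurable_EFin _ _ _ (fun w => `|X w|) setT (strong_norm sX)).
have iBxi := subT _ sxi ixi; have iBY := subT _ sY iY.
have i1 := integrable_inner u mB sxi iBxi.
have i2 := integrable_inner u mB sY iBY.
have -> : (\int[P]_(w in B) (inner (xi w - v w) u)%:E =
    \int[P]_(w in B) ((inner (xi w) u)%:E - (inner (Y w) u)%:E))%E.
  apply: ae_eq_integral => //.
  - exact: (@strong_measurable_EFin _ _ _ (fun w => inner (xi w - v w) u) B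
      (strong_inner qe.1 (strong_cst u))).
  - by apply: emeasurable_funB; apply: measurable_int; [exact: i1|exact: i2].
  - by move: aeY; apply: filterS => w Yv _; rewrite -EFinB -innerBl Yv.
rewrite integralB// (integral_inner_bochner u mB sxi iBxi bxi).
by rewrite (integral_inner_bochner u mB sY iBY bY) subee.
Qed.

(** For a simple direction, the integral splits over level sets and each piece vanishes. The general
    case follows by dominated convergence: approximants bounded by [2 |W|] are dominated by
    [|xi - v|^2 + |W|^2]. *)
Lemma cond_mean_eq_orthogonal (xi v W : T -> H) :
  cond_mean_eq P <<s G >> xi v ->
  square_integrable P (fun w => xi w - v w) ->
  strongly_measurable <<s G >> W -> square_integrable P W ->
  (\int[P]_w (inner (xi w - v w) (W w))%:E = 0)%E.
Proof.
move=> cxi qe sW qW.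
(* The same points with the smaller sigma-algebra, so that results on measurable types apply to
   it. *)
pose T' := g_sigma_algebraType G.
have sW' : strongly_measurable (@measurable _ T') W by exact: sW.
have [s [ss sc sb]] : exists s : nat -> T -> H,
    [/\ forall n, simple_wrt <<s G >> (s n),
        forall w, s n w @[n --> \oo] --> W w &
        forall n w, `|s n w| <= 2 * `|W w|].
  exact: (@strong_dominated_approximation R H _ _ T' T' id W sW'
    (fun U => @strong_open_preimage R _ T' H W U sW')).
have ssT n : simple_wrt measurable (s n).
  by split; [exact: (ss n).1|move=> u; apply: G_measurable; exact: (ss n).2].
have iu u : P.-integrable setT (fun w => (inner (xi w - v w) u)%:E).
  exact: (integrable_inner_prod qe (square_integrable_cst P u)).
have I0 n : (\int[P]_w (inner (xi w - v w) (s n w))%:E = 0)%E.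
  pose r : seq H := finmap.enum_fset (fset_set (range (s n))).
  have [] := @integral_simple_decomp _ _ _ _ P setT (s n) r
    (fun w u => inner (xi w - v w) u) measurableT (ssT n) _ _ iu.
  - exact: finmap.fset_uniq.
  - by move=> u us; rewrite /= in_fset_set ?mem_set//; exact: (ss n).1.
  move=> _ ->; rewrite big1// => u _; rewrite setTI.
  exact: cond_mean_eq_integral cxi qe ((ss n).2 u).
have iB : P.-integrable setT
    (fun w => ((`|xi w - v w| ^+ 2)%:E + (`|W w| ^+ 2)%:E)%E).
  apply: integrableD => //; first exact: (square_integrableP qe).2.
  exact: (square_integrableP qW).2.
have := @dominated_cvg _ _ _ P setT measurableT
  (fun n w => (inner (xi w - v w) (s n w))%:E)
  (fun w => (inner (xi w - v w) (W w))%:E) _ _ _ _ iB.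
have c0 : (\int[P]_w (inner (xi w - v w) (s n w))%:E)%E @[n --> \oo] --> 0%E.
  under eq_fun do rewrite I0; exact: cvg_cst.
move=> h; have {h} h := h _ _ _ _.
rewrite -(cvg_lim (@ereal_hausdorff R) c0); apply/esym.
apply: cvg_lim; first exact: ereal_hausdorff.
apply: h => [n|w _|w _|n w _].
- apply/measurable_EFinP; apply: strong_measurable_fun.
  exact: strong_inner qe.1 (simple_strong (ssT n)).
- apply: cvg_EFin; first by near=> n.
  exact: (cvg_comp _ _ (sc w) (@inner_continuous R H (xi w - v w) (W w))).
- by rewrite -EFinD.
- rewrite -EFinD /= lee_fin; apply: le_trans (inner_cauchy _ _) _.
  apply: le_trans (ler_wpM2l _ (sb n w)) _ => //.
  by have := sqr_ge0 (`|xi w - v w| - `|W w|); lra.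
Unshelve. all: by end_near. Qed.

End conditional_orthogonality.

Section filtration.
Context {R : realType} {V : normedModType R}.
Context {d : measure_display} {T : measurableType d} (x : nat -> T -> V).

Lemma sigma_upto_measurable k :
  (forall i, (i <= k)%N -> strongly_measurable measurable (x i)) ->
  forall A, sigma_upto x k A -> measurable A.
Proof.
move=> sx; apply: smallest_sub; first exact: sigma_algebra_measurable.
move=> _ [i /= ik [B GB <-]]; rewrite setTI.
suff : <<s @open V >> `<=` [set B | measurable (x i @^-1` B)] by exact.
apply: smallest_sub.
  split=> [|C mC|F mF] /=; first by rewrite preimage_set0.
    exact: (measurableD measurableT mC).
  by rewrite preimage_bigcup; apply: bigcup_measurable => n _; exact: mF.
by move=> U oU; exact: strong_open_preimage (sx i ik) oU.
Qed.

(** Preimages of open sets lie in the generated sigma-algebra by construction, but the simple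
    approximants given with [x i] need not be measurable for it; new ones are built. *)
Lemma strong_sigma_upto k i : (i <= k)%N ->
  strongly_measurable measurable (x i) ->
  strongly_measurable (sigma_upto x k) (x i).
Proof.
move=> ik sxi.
pose T' := g_sigma_algebraType
  (\bigcup_(i in `I_k.+1) preimage_set_system setT (x i) <<s @open V >>).
have [U oU|s [ss sc _]] := @strong_dominated_approximation R V _ _ T T' id (x i) sxi.
  apply: sub_sigma_algebra; exists i => //; exists U; last by rewrite setTI.
  exact: sub_sigma_algebra.
by exists s.
Qed.

End filtration.

Section expectation.
Context {R : realType} {d : measure_display} {T : measurableType d}.
Context (P : probability T R).

(* The integral of a nonnegative function is a supremum over the simple
   functions below it, whether or not it is measurable. *)
Lemma ge0_le_integral_nonmeasurable (f g : T -> \bar R) :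
  (forall w, 0 <= f w)%E -> (forall w, f w <= g w)%E ->
  (\int[P]_w f w <= \int[P]_w g w)%E.
Proof.
move=> f0 fg; have g0 w : (0 <= g w)%E by exact: le_trans (fg w).
rewrite !ge0_integralE//; apply: le_ereal_sup => _ [h hf <-]; exists h => // w.
by apply: le_trans (hf w) _; rewrite !patchE; case: ifP.
Qed.

Lemma expectation_sum_le (n : nat) (h : nat -> T -> R) (c : nat -> R) :
  (forall k, P.-integrable setT (fun w => (h k w)%:E)) ->
  (forall k, \int[P]_w (h k w)%:E <= (c k)%:E)%E ->
  P.-integrable setT (fun w => (\sum_(0 <= k < n) h k w)%:E) /\
  (\int[P]_w (\sum_(0 <= k < n) h k w)%:E <= (\sum_(0 <= k < n) c k)%:E)%E.
Proof.
move=> ih hc; split.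
  under [X in _.-integrable _ X]eq_fun do rewrite -sumEFin.
  by apply: integrable_sum.
under eq_integral do rewrite -sumEFin.
by rewrite integral_sum// -sumEFin; apply: lee_sum => k _.
Qed.

Lemma cond_mean_le_integral (S : set_system T) (X : T -> \bar R) (c : R) :
  S setT -> (forall A, S A -> measurable A) ->
  cond_mean_le P S X c%:E -> 0 <= c -> (\int[P]_w X w <= c%:E)%E.
Proof.
move=> ST Sm [Y [_ mY Y0 XY] Yc] c0; rewrite XY//.
have ic := finite_measure_integrable_cst P c measurableT.
apply: (@le_trans _ _ (\int[P]_w (EFin \o cst c) w)%E).
  apply: ae_ge0_le_integral => //.
  - by move=> _ B mB; rewrite setTI; apply: Sm; exact: mY.
  - exact: measurable_int ic.
  - by move: Yc; apply: filterS => w Yw _.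
have -> : (\int[P]_w (EFin \o cst c) w = c%:E * P setT)%E.
  exact: (integral_cst P measurableT c%:E).
by have -> : P setT = 1%E := probability_setT P; rewrite mule1.
Qed.

End expectation.

(** * Moments of the noise *)

Section sVAST_expectation.
Context {R : realType} {H G : hilbertType R}.
Context {d : measure_display} {T : measurableType d} (P : probability T R).
Context (f : H -> \bar R) (g : G -> R) (L : R) (K : {linear H -> G}).
Context (mu t : nat -> R) (sigma : R) (x0 : H) (xi x y : nat -> T -> H).
Hypothesis f_proper : proper_ereal f.
Hypothesis f_convex : convex_ereal f.
Hypothesis f_lsc : lower_semicontinuous f.
Hypothesis g_convex : convex_function setT g.
Hypothesis g_lip : L.-lipschitz (g : G -> R^o).
Hypothesis K_continuous : continuous K.
Hypothesis K_neq0 : exists u, K u != 0.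
Hypothesis mu_gt0 : forall k, (1 <= k)%N -> 0 < mu k.
Hypothesis iterates : sVAST_iterates f K mu t xi x0 x y.
Hypothesis oracle : sVAST_oracle g K mu sigma P xi x y.
Context (xstar : H).

Local Notation strong := (strongly_measurable (@measurable d T)).
Local Notation sqi := (square_integrable P).
Local Notation eps k w := (noise g mu K (y^~ w) (xi^~ w) k).
Local Notation dir k w := (noise_direction f g mu t K (x^~ w) (y^~ w) xstar k).

Let grad_lip k : exists c, forall u v,
  `|smoothed_gradient g K (mu k.+1) u - smoothed_gradient g K (mu k.+1) v|
    <= c * `|u - v|.
Proof.
eexists => u v.
exact: (smoothed_gradient_lipschitz g_convex g_lip (mu_gt0 (ltn0Sn k))
  K_continuous u v).
Qed.

Let step_lip k : exists c, forall u v,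
  `|prox_step f (mu k.+1) K (smoothed_gradient g K (mu k.+1) u) u
    - prox_step f (mu k.+1) K (smoothed_gradient g K (mu k.+1) v) v|
    <= c * `|u - v|.
Proof.
have [c hc] := grad_lip k.
exists (1 + `|1 / (opnorm K ^+ 2 / mu k.+1)| * c) => u v.
apply: le_trans (prox_step_nonexpansive f_proper f_convex f_lsc
  (mu_gt0 (ltn0Sn k)) K_continuous K_neq0 _ _ _ _) _.
rewrite opprB [X in _ + X]addrC addrACA [X in _ + X]addrC -scalerBr.
rewrite mulrDl; apply: le_trans (ler_normD _ _) _.
apply: lerD; first by rewrite mul1r.
by rewrite normrZ -[leRHS]mulrA ler_wpM2l// (distrC u v).
Qed.

(** Conditional on the iterates up to [k], so that it can be used inside the induction that
    establishes their square integrability. *)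
Let prefix_facts k : (forall i, (i <= k)%N -> sqi (x i)) -> sqi (y k) ->
  (forall A, sigma_upto x k A -> measurable A) /\
  sqi (fun w => eps k w) /\ (\int[P]_w (`|eps k w| ^+ 2)%:E <= (sigma ^+ 2)%:E)%E.
Proof.
move=> qx qy; have [cm cv] := oracle k.
have Sm : forall A, sigma_upto x k A -> measurable A.
  by apply: sigma_upto_measurable => i ik; exact: (qx i ik).1.
have le2 : (\int[P]_w (`|eps k w| ^+ 2)%:E <= (sigma ^+ 2)%:E)%E.
  apply: cond_mean_le_integral Sm cv (sqr_ge0 _).
  exact: (@measurableT _ (g_sigma_algebraType
    (\bigcup_(i in `I_k.+1) preimage_set_system setT (x i) <<s @open H >>))).
have [c hc] := grad_lip k.
split=> //; split=> //; split; last by rewrite (le_lt_trans le2)// ltry.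
have [Y [[sxi _] _ _ _] _] := cm.
exact: strongB sxi (strong_comp (lipschitz_map_continuous hc) qy.1).
Qed.

Lemma square_integrable_iterates k :
  (forall i, (i <= k)%N -> sqi (x i)) /\ sqi (y k).
Proof.
have [x0E y0E xSE ySE] := iterates.
elim: k => [|k [qx qy]].
  have -> : y 0%N = cst x0 by exact/funext.
  split=> [i|]; last exact: square_integrable_cst.
  rewrite leqn0 => /eqP ->; have -> : x 0%N = cst x0 by exact/funext.
  exact: square_integrable_cst.
have [_ [qe _]] := prefix_facts qx qy.
have [c hc] := grad_lip k.
have qxi : sqi (xi k).
  have -> : xi k = (fun w => eps k w + smoothed_gradient g K (mu k.+1) (y k w)).
    by apply/funext => w; rewrite subrK.
  exact: square_integrableD qe (square_integrable_lipschitz hc qy).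
have qxS : sqi (x k.+1).
  (* With zero gradient [prox_step] is the bare proximal map, which is 1-Lipschitz. *)
  rewrite (_ : x k.+1 = fun w => prox_step f (mu k.+1) K 0
     (y k w - (1 / (opnorm K ^+ 2 / mu k.+1)) *: xi k w)); last first.
    by apply/funext => w; rewrite xSE /prox_step scaler0 subr0.
  apply: (@square_integrable_lipschitz _ _ _ _ _ _ (prox_step f (mu k.+1) K 0) 1).
    move=> u v; apply: le_trans (prox_step_nonexpansive f_proper f_convex f_lsc
      (mu_gt0 (ltn0Sn k)) K_continuous K_neq0 _ _ _ _) _.
    by rewrite scaler0 !subr0 mul1r.
  exact: square_integrableB qy (square_integrableZ _ qxi).
split=> [i|]; first by rewrite leq_eqVlt => /predU1P[->//|]; exact: qx.
have -> : y k.+1 = fun w =>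
    x k.+1 w + ((t k.+1 - 1) / t k.+2) *: (x k.+1 w - x k w) by exact/funext.
have qd := square_integrableB qxS (qx k (leqnn k)).
exact: square_integrableD qxS (square_integrableZ _ qd).
Qed.

Lemma noise_second_moment k :
  sqi (fun w => eps k w) /\ (\int[P]_w (`|eps k w| ^+ 2)%:E <= (sigma ^+ 2)%:E)%E.
Proof.
by have [qx qy] := square_integrable_iterates k; have [] := prefix_facts qx qy.
Qed.

Lemma square_integrable_direction k : sqi (fun w => dir k w).
Proof.
have [qx qy] := square_integrable_iterates k; have [c hc] := step_lip k.
apply: square_integrableB; last exact: square_integrable_lipschitz hc qy.
exact: square_integrableD (square_integrableZ _ (qx k (leqnn k)))
  (square_integrable_cst _ _).
Qed.

Lemma noise_orthogonal k : (\int[P]_w (inner (eps k w) (dir k w))%:E = 0)%E.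
Proof.
have [x0E y0E xSE ySE] := iterates.
have [qx qy] := square_integrable_iterates k.
have [Sm [qe _]] := prefix_facts qx qy; have [c hc] := step_lip k.
apply: (cond_mean_eq_orthogonal Sm (oracle k).1 qe) (square_integrable_direction k).
pose T' := g_sigma_algebraType
  (\bigcup_(i in `I_k.+1) preimage_set_system setT (x i) <<s @open H >>).
have sx i : (i <= k)%N -> strongly_measurable (@measurable _ T') (x i).
  by move=> ik; exact: strong_sigma_upto ik (qx i ik).1.
have sy : strongly_measurable (@measurable _ T') (y k).
  (* [y 0] is constant; every later [y k] combines [x k] and the preceding iterate, both known to
     the past. *)
  have [k0|[i ki]] : k = 0%N \/ exists i, k = i.+1.
    by case: (k) => [|i]; [left|right; exists i].
    have -> : y k = cst x0 by rewrite k0; exact/funext.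
    exact: strong_cst.
  have -> : y k = fun w => x k w + ((t i.+1 - 1) / t i.+2) *: (x k w - x i w).
    by rewrite ki; apply/funext => w; exact: ySE.
  have ik : (i <= k)%N by rewrite ki.
  exact: (@strongD R _ T' _ _ _ (sx k (leqnn k))
    (strongZ _ (strongB (sx k (leqnn k)) (sx i ik)))).
apply: (@strongB R _ T').
  exact: (@strongD R _ T' _ _ _ (strongZ _ (sx k (leqnn k))) (strong_cst _)).
exact: (@strong_comp R _ T' _ _ _ _ (lipschitz_map_continuous hc) sy).
Qed.

End sVAST_expectation.


Theorem theorem4p1 (R : realType) (H G : hilbertType R)
  (d : measure_display) (T : measurableType d) (P : probability T R)
  (f : H -> \bar R) (g : G -> R) (Lg : R) (K : {linear H -> G})
  (mu t rho : nat -> R) (sigma : R) (x0 : H) (xi x y : nat -> T -> H)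
  (f_proper : proper_ereal f) (f_convex : convex_ereal f)
  (f_lsc : lower_semicontinuous f)
  (g_convex : convex_function setT g)
  (Lg_gt0 : 0 < Lg) (g_lipschitz : Lg.-lipschitz (g : G -> R^o))
  (K_continuous : continuous K) (K_neq0 : exists u, K u != 0)
  (mu_gt0 : forall k, (1 <= k)%N -> 0 < mu k)
  (mu_nonincreasing : forall k, (1 <= k)%N -> mu k.+1 <= mu k)
  (t1 : t 1%N = 1) (t_ge1 : forall k, (2 <= k)%N -> 1 <= t k)
  (sigma_ge0 : 0 <= sigma)
  (iterates : sVAST_iterates f K mu t xi x0 x y)
  (oracle : sVAST_oracle g K mu sigma P xi x y)
  (rho1 : rho 1%N = 0)
  (rhoS : forall k, (1 <= k)%N ->
     rho k.+1 = t k ^+ 2 - t k.+1 ^+ 2 + t k.+1)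
  (rho_ge0 : forall k, (1 <= k)%N -> 0 <= rho k.+1)
  (xstar : H)
  (xstar_opt : forall u, (objective f g K xstar <= objective f g K u)%E)
  (N : nat) (N_ge1 : (1 <= N)%N) :
  (\int[P]_w (objective f g K (x N w) - objective f g K xstar) <=
   (1 / (stepsize K mu N * t N ^+ 2) * (1 / 2 * `|x0 - xstar| ^+ 2)
    + 1 / (stepsize K mu N * t N ^+ 2) * (Lg ^+ 2 / (2 * opnorm K ^+ 2))
      * (\sum_(1 <= k < N.+1) mu k ^+ 2 * (t k + rho k))
    + 1 / (stepsize K mu N * t N ^+ 2)
      * (sigma ^+ 2 / opnorm K ^+ 4 + (Lg ^+ 2 + 1) / (2 * opnorm K ^+ 2))
      * (\sum_(1 <= k < N.+1) t k ^+ 2 * mu k ^+ 2))%:E)%E.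
Proof.
(* From here sums start at 0: index [k] pairs the noise at [y k] with the parameters of step
   [k.+1]. *)
case: N N_ge1 => // n _.
have [x0E y0E xSE ySE] := iterates.
pose s := stepsize K mu.
have s0 k : 0 < s k.+1 by exact: stepsize_gt0.
have tS k : 1 <= t k.+1 by case: k => [|k]; [rewrite t1|exact: t_ge1].
have k0 : 0 < opnorm K by exact: opnorm_gt0.
pose eps k w := noise g mu K (y^~ w) (xi^~ w) k.
pose dir k w := noise_direction f g mu t K (x^~ w) (y^~ w) xstar k.
pose h k w := s k.+1 * t k.+1 ^+ 2 * (mu k.+1 * Lg ^+ 2 / 2)
  + s k.+1 ^+ 2 * t k.+1 ^+ 2 * `|eps k w| ^+ 2
  + s k.+1 * t k.+1 ^+ 2 * inner (eps k w) (dir k w).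
pose b k := s k.+1 * t k.+1 ^+ 2 * (mu k.+1 * Lg ^+ 2 / 2)
  + s k.+1 ^+ 2 * t k.+1 ^+ 2 * sigma ^+ 2.
pose c := s n.+1 * t n.+1 ^+ 2.
have c0 : 0 < c by rewrite mulr_gt0// exprn_gt0// (lt_le_trans _ (tS n)).
have bound w : c * gap f g K xstar (x n.+1 w) <=
    2^-1 * `|x0 - xstar| ^+ 2 + \sum_(0 <= k < n.+1) h k w.
  exact: (@pathwise_bound R H G f g Lg mu t rho K f_proper f_convex f_lsc
    g_convex g_lipschitz K_continuous K_neq0 mu_gt0 mu_nonincreasing t1 t_ge1
    rhoS rho_ge0 x0 (x^~ w) (y^~ w) (xi^~ w) (y0E w) (xSE^~ w) (ySE^~ w)
    xstar xstar_opt n).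
have moments k := noise_second_moment f_proper f_convex f_lsc g_convex
  g_lipschitz K_continuous K_neq0 mu_gt0 iterates oracle k.
have direction k := square_integrable_direction f_proper f_convex f_lsc g_convex
  g_lipschitz K_continuous K_neq0 mu_gt0 iterates oracle xstar k.
have orth k := noise_orthogonal f_proper f_convex f_lsc g_convex
  g_lipschitz K_continuous K_neq0 mu_gt0 iterates oracle xstar k.
have icst (r : R) : P.-integrable setT (fun=> r%:E).
  exact: finite_measure_integrable_cst.
have Ecst (r : R) : (\int[P]_w r%:E = r%:E)%E.
  have -> : (\int[P]_w r%:E = r%:E * P setT)%E := integral_cst P measurableT r%:E.
  by have -> : P setT = 1%E := probability_setT P; rewrite mule1.
have ieps k : P.-integrable setT (fun w => (`|eps k w| ^+ 2)%:E).
  exact: (square_integrableP (moments k).1).2.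
have iprod k : P.-integrable setT (fun w => (inner (eps k w) (dir k w))%:E).
  exact: integrable_inner_prod (moments k).1 (direction k).
have hE k : (fun w => (h k w)%:E) = (fun w =>
   (s k.+1 * t k.+1 ^+ 2 * (mu k.+1 * Lg ^+ 2 / 2))%:E
  + (s k.+1 ^+ 2 * t k.+1 ^+ 2)%:E * (`|eps k w| ^+ 2)%:E
  + (s k.+1 * t k.+1 ^+ 2)%:E * (inner (eps k w) (dir k w))%:E)%E by [].
have ih k : P.-integrable setT (fun w => (h k w)%:E).
  rewrite hE; apply: integrableD => //; last exact: integrableZl.
  by apply: integrableD => //; exact: integrableZl.
have Eh k : (\int[P]_w (h k w)%:E <= (b k)%:E)%E.
  rewrite hE integralD//; last 2 first.
  - by apply: integrableD => //; exact: integrableZl.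
  - exact: integrableZl.
  rewrite integralD//; last exact: integrableZl.
  rewrite !integralZl// orth mule0 adde0 Ecst /b EFinD.
  apply: leeD2l; rewrite [leRHS]EFinM; apply: lee_wpmul2l.
    by rewrite lee_fin mulr_ge0 ?sqr_ge0.
  exact: (moments k).2.
have [iS ES] := expectation_sum_le n.+1 ih Eh.
have fx w : f (x n.+1 w) \is a fin_num.
  exact: (@x_fin _ _ _ _ _ _ f_proper f_convex f_lsc K_continuous K_neq0 mu_gt0
    (x^~ w) (y^~ w) (xi^~ w) (xSE^~ w) n).
have gapE w : (objective f g K (x n.+1 w) - objective f g K xstar)%E =
    (gap f g K xstar (x n.+1 w))%:E.
  rewrite /objective /gap -(fineK (fx w)) -(fineK (xstar_fin f_proper xstar_opt)).
  by rewrite -!EFinD.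
have iM : P.-integrable setT (fun w =>
    (2^-1 * `|x0 - xstar| ^+ 2 + \sum_(0 <= k < n.+1) h k w)%:E).
  exact: integrableD (icst _) iS.
apply: (@le_trans _ _ (\int[P]_w (c^-1%:E *
    (2^-1 * `|x0 - xstar| ^+ 2 + \sum_(0 <= k < n.+1) h k w)%:E))%E).
  (* Optimality of [xstar] makes the gap nonnegative, so it can be integrated without proving it
     measurable. *)
  apply: ge0_le_integral_nonmeasurable => w; rewrite gapE.
    by rewrite lee_fin; exact: (@gap_ge0 R H G f g K f_proper xstar xstar_opt _ (fx w)).
  by rewrite -EFinM lee_fin ler_pdivlMl.
rewrite integralZl//.
have EM : (\int[P]_w (2^-1 * `|x0 - xstar| ^+ 2 + \sum_(0 <= k < n.+1) h k w)%:E
    <= (2^-1 * `|x0 - xstar| ^+ 2 + \sum_(0 <= k < n.+1) b k)%:E)%E.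
  under eq_integral do rewrite EFinD.
  by rewrite integralD// Ecst EFinD leeD2l.
apply: le_trans (lee_wpmul2l _ EM) _; first by rewrite lee_fin invr_ge0 ltW.
rewrite -EFinM lee_fin -/(s n.+1) -/c div1r -!mulrA -!mulrDr ler_pM2l ?invr_gt0//.
rewrite mul1r !(big_add1 _ _ 0 n.+2) /=.
(* With [s k = mu k / |K|^2], the smoothing error gives [Lg^2 / (2 |K|^2)] and the noise
   [sigma^2 / |K|^4], both times [t k^2 mu k^2]. The rest of the claimed bound is nonnegative by
   [S1] and [S2]. *)
have Eb : \sum_(0 <= k < n.+1) b k =
  (sigma ^+ 2 / opnorm K ^+ 4 + Lg ^+ 2 / (2 * opnorm K ^+ 2)) *
    \sum_(0 <= k < n.+1) t k.+1 ^+ 2 * mu k.+1 ^+ 2.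
  rewrite mulr_sumr; apply: eq_bigr => k _; rewrite /b /s stepsizeE.
  by field; rewrite gt_eqF.
have S1 : 0 <= \sum_(0 <= k < n.+1) mu k.+1 ^+ 2 * (t k.+1 + rho k.+1).
  apply: sumr_ge0 => k _; rewrite mulr_ge0 ?sqr_ge0// addr_ge0//.
    exact: le_trans (tS k).
  by case: k => [|k]; [rewrite rho1|exact: rho_ge0].
have S2 : 0 <= \sum_(0 <= k < n.+1) t k.+1 ^+ 2 * mu k.+1 ^+ 2.
  by apply: sumr_ge0 => k _; rewrite mulr_ge0 ?sqr_ge0.
have q0 : 0 <= (2 * opnorm K ^+ 2)^-1.
  by rewrite invr_ge0 mulr_ge0// exprn_ge0// ltW.
have := mulr_ge0 (sqr_ge0 Lg) (mulr_ge0 q0 S1); have := mulr_ge0 q0 S2.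
rewrite Eb; move: (\sum_(0 <= k < n.+1) _) (\sum_(0 <= k < n.+1) _) => S S'.
move: ((2 * opnorm K ^+ 2)^-1) ((opnorm K ^+ 4)^-1) => q q'.
lra.
Qed.
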